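(* Let $X_1,\dots,X_n$ be $n$ independent copies of a random vector $X\in\mathbb{R}^d$. Assume that for some known constant $\kappa$ $$\sup\bigl\{\mathbb{E}(\langle\theta,X\rangle^4)\,:\,\theta\in\mathbb{R}^d,\ \mathbb{E}(\langle\theta,X\rangle^2)\le 1\bigr\}\le\kappa<\infty .$$ Choose $$\lambda=\sqrt{\frac{2}{(\kappa-1)n}\bigl[\log(\epsilon^{-1})+0.73\,d\bigr]},\quad\text{and consider}\quad \mu=\sqrt{\frac{2(\kappa-1)}{n}\bigl[\log(\epsilon^{-1})+0.73\,d\bigr]}+6.81\sqrt{\frac{2\kappa d}{n}} .$$ For any confidence parameter $\epsilon>0$ and any sample size $n$ such that $$n>\Biggl[20\sqrt{\kappa d}+\Bigl(\frac52+\frac1{2(\kappa-1)}\Bigr)\sqrt{2(\kappa-1)\bigl[\log(\epsilon^{-1})+0.73\,d\bigr]}\Biggr]^2=\mathbf{O}\bigl(\kappa[d+\log(\epsilon^{-1})]\bigr),$$ with probability at least $1-2\epsilon$, for any $\theta\in\mathbb{R}^d$, $$\left|\frac{N(\theta)}{\widehat N_\lambda(\theta)}-1\right|\le\frac{\mu}{1-2\mu}=\mathbf{O}\Biggl(\sqrt{\frac{\kappa[d+\log(\epsilon^{-1})]}{n}}\Biggr).$$ Moreover this inequality can be decomposed into two inequalities (by removing the absolute value), namely $N(\theta)/\widehat N_\lambda(\theta)-1\le\mu/(1-2\mu)$ for any $\theta\in\mathbb{R}^d$, and $1-N(\theta)/\widehat N_\lambda(\theta)\le\mu/(1-2\mu)$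 for any $\theta\in\mathbb{R}^d$, that hold each with probability at least $1-\epsilon$.
   Context: $N(\theta)=\mathbb{E}(\langle\theta,X\rangle^2)$ for $\theta\in\mathbb{R}^d$. The influence function $\psi:\mathbb{R}\to\mathbb{R}$ is $\psi(x)=\log 2$ for $x\ge1$, $\psi(x)=-\log(1-x+x^2/2)$ for $0\le x\le1$, and $\psi(x)=-\psi(-x)$ for $x\le0$. The estimator is $\widehat N_\lambda(\theta)=\inf\bigl\{\rho>0:\ \sum_{i=1}^n\psi\bigl[\lambda(\rho^{-1}\langle\theta,X_i\rangle^2-1)\bigr]\le0\bigr\}$. Convention: $z/0=1$ if $z=0$ and $z/0=+\infty$ if $z>0$. $A=\mathbf{O}(B)$ means that there is a numerical constant $c$ such that $A\le cB$.
   Formalization: Assumes N(θ)<∞ for all θ and κ>1. The O-bound on the sample-size threshold is false as κ→1, so it is stated with a constant depending on κ0, for all κ≥κ0>1. Both O-bounds are stated only for 0<ε≤1. *)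

(* Defs.v *)
From HB Require Import structures.
From mathcomp Require Import all_boot all_order all_algebra.
From mathcomp Require Import all_classical all_reals all_analysis.

Set Implicit Arguments.
Unset Strict Implicit.
Unset Printing Implicit Defensive.

Import Order.TTheory GRing.Theory Num.Theory.
Import numFieldNormedType.Exports.

Local Open Scope classical_set_scope.
Local Open Scope ring_scope.

(* R^d is [d.-tuple R], which carries the product sigma-algebra, that is, the
   Borel sigma-algebra of R^d. *)
Definition dotp (R : realType) (d : nat) (t x : d.-tuple R) : R :=
  \sum_(i < d) tnth t i * tnth x i.

(* [moment p P X t] is E(<t, X>^p). For even p it is the integral of a
   nonnegative function, so it always makes sense in [0, +oo]. *)
Definition moment (R : realType) (d : nat) (p : nat) disp
    (T : measurableType disp) (P : probability T R)
    (X : {RV P >-> d.-tuple R}) (t : d.-tuple R) : \bar R :=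
  'E_P[(fun w => dotp t (X w) ^+ p)%R]%E.

Definition Nfun (R : realType) (d : nat) disp (T : measurableType disp)
    (P : probability T R) (X : {RV P >-> d.-tuple R}) (t : d.-tuple R) : \bar R :=
  moment 2 X t.

Definition mutually_independent (R : realType) disp disp'
    (T : measurableType disp) (T' : measurableType disp')
    (P : probability T R) (I : finType) (Y : I -> {RV P >-> T'}) : Prop :=
  forall (J : {set I}) (A : I -> set T'),
    (forall i, i \in J -> measurable (A i)) ->
    P (\bigcap_(i in [set` J]) (Y i @^-1` A i)) =
    (\prod_(i in J) P (Y i @^-1` A i))%E.

Definition independent_copies (R : realType) disp0 disp disp'
    (T0 : measurableType disp0) (T : measurableType disp)
    (T' : measurableType disp') (P0 : probability T0 R) (P : probability T R)
    (X : {RV P0 >-> T'}) (I : finType) (Y : I -> {RV P >-> T'}) : Prop :=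
  mutually_independent Y /\
  forall i (A : set T'), measurable A -> distribution P (Y i) A = distribution P0 X A.

(* The set on which [Q] holds need not be measurable when [Q] quantifies over a
   continuum of directions, hence the passage through a measurable event
   contained in it. *)
Definition holds_with_prob_ge (R : realType) disp (T : measurableType disp)
    (P : probability T R) (p : R) (Q : T -> Prop) : Prop :=
  exists A : set T, [/\ measurable A, (p%:E <= P A)%E & A `<=` [set w | Q w]].

Definition psi_nonneg (R : realType) (x : R) : R :=
  if 1 <= x then ln 2 else - ln (1 - x + x ^+ 2 / 2).

Definition psi (R : realType) (x : R) : R :=
  if 0 <= x then psi_nonneg x else - psi_nonneg (- x).

(* The infimum is taken in the extended reals, where inf of the empty set
   is +oo. *)
Definition Nhat (R : realType) (d n : nat) (lambda : R)
    (x : 'I_n -> d.-tuple R) (t : d.-tuple R) : \bar R :=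
  ereal_inf [set rho%:E | rho in
    [set rho : R | 0 < rho /\
      \sum_(i < n) psi (lambda * (rho^-1 * dotp t (x i) ^+ 2 - 1)) <= 0]].

(* Division of nonnegative extended reals with z / 0 = 1 if z = 0 and
   z / 0 = +oo if z > 0. *)
Definition ediv_conv (R : realType) (z y : \bar R) : \bar R :=
  (if y == 0 then (if z == 0 then 1 else +oo) else z / y)%E.

Section Constants.
Variables (R : realType) (kappa : R) (n d : nat) (eps : R).

Definition dev_term : R := ln eps^-1 + 73 / 100 * d%:R.

Definition lambda_choice : R :=
  Num.sqrt (2 / ((kappa - 1) * n%:R) * dev_term).

Definition mu_choice : R :=
  Num.sqrt (2 * (kappa - 1) / n%:R * dev_term) +
  681 / 100 * Num.sqrt (2 * kappa * d%:R / n%:R).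

(* Diverges as kappa decreases to 1 (with d and eps fixed), so that it is bounded
   by a multiple of kappa * (d + ln eps^-1) only for kappa bounded away from 1. *)
Definition sample_threshold : R :=
  (20 * Num.sqrt (kappa * d%:R) +
   (5 / 2 + 1 / (2 * (kappa - 1))) *
     Num.sqrt (2 * (kappa - 1) * dev_term)) ^+ 2.

End Constants.

(* Main.v *)
Require Import Defs.
From HB Require Import structures.
From mathcomp Require Import all_boot all_order all_algebra.
From mathcomp Require Import all_classical all_reals all_analysis.
From mathcomp Require Import measurable_realfun ring lra zify.

Set Implicit Arguments.
Unset Strict Implicit.
Unset Printing Implicit Defensive.

Import Order.TTheory GRing.Theory Num.Theory.
Import numFieldNormedType.Exports.

Local Open Scope classical_set_scope.
Local Open Scope ring_scope.

(** Why the theorem is true.  The first claim is a uniform deviation bound; the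
two orders of magnitude in the second and third claims are elementary
([threshold_order], [rate_order]).

Modulo the directions along which <t, X> vanishes almost surely, the quadratic
form t |-> E <t, X>^2 has an orthonormal family of r <= d linear forms
([isotropic_coordinates]).  In these coordinates <t, X> = sum_i c_i f_i(X),
N(t) = sum_i c_i^2 =: xi, and the hypothesis on fourth moments bounds every mixed
fourth moment of the f_i by kappa.  Since psi is nondecreasing and the empirical
criterion depends on t and rho only through t / sqrt rho, bounding Nhat(t) from
one side amounts to controlling the sign of sum_i psi (lam (<t, X_i>^2 - 1)) at
one value of xi: xi = 1 + delta for the first inequality and xi = 1 - delta for
the second, where delta = mu / (1 - 2 mu).

A single direction would be handled by psi x <= ln (1 + x + x^2 / 2), the oddness
of psi and Markov's inequality for exponentials.  Uniformity over directions
comes from a PAC-Bayes argument: the direction c is replaced by a random point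
c + w, the mean over w of a log-likelihood is compared with the logarithm of its
exponential mean under a fixed prior, and the entropy of the law of c + w relative
to the prior is the price of uniformity.  The perturbation lives on a grid of step
2 sqrt v and each coordinate follows a quadratic B-spline law
([spline_op], [grid_op]).  Like a Gaussian law it has the prescribed mean and a
variance v which is the same for all centers, but its expectations are finite
sums, so that no integral over directions and no Fubini theorem is needed.  With
the geometric prior [prior_weight] the relative entropy is at most
0.73 r + 0.7 xi / (4 v) ([grid_prior_entropy]): the first term is the 0.73 d of
the statement, and the second one is balanced against the variance created by the
perturbation through the choice of v in [deviation_bound_le].

Two steps carry the argument.  Because psi is bounded it is not convex, so that
psi (mean) <= mean psi fails; [reverse_jensen_pointwise] restores such an
inequality by adding inside the logarithm a polynomial correction of the order of
the variance of the perturbation ([slack]).  And [uniform_deviation_event] puts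
the PAC-Bayes inequality, this correction and the moment computation
[grid_smoothed_mean] together.  What remains is the discussion of a quadratic
inequality, which delta = mu / (1 - 2 mu) satisfies under the sample size
condition ([lower_side_neg], [upper_side_neg]). *)


(** * Logarithmic inequalities and the influence function *)

Section LogBounds.
Variable R : realType.
Implicit Types x y z : R.

Lemma ln_le_sub1 x : 0 < x -> ln x <= x - 1.
Proof.
move=> x0; have := @le_ln1Dx R (x - 1).
by rewrite [1 + _]addrC subrK; apply; rewrite ltrBrDl subrr.
Qed.

Lemma ln_ge_1subV x : 0 < x -> 1 - x^-1 <= ln x.
Proof.
move=> x0; have xi0 : 0 < x^-1 by rewrite invr_gt0.
by have := ln_le_sub1 xi0; rewrite lnV ?posrE//; lra.
Qed.

(** From expR (7/640) >= 1 + 7/640, by squaring six times. *)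
Lemma ln2_le : ln 2 <= 7 / 10 :> R.
Proof.
rewrite -[leRHS]expRK ler_ln ?posrE ?expR_gt0//.
have -> : 7 / 10 = 64%:R * (7 / 640) :> R by lra.
rewrite expRM_natl -[64%N]/(2 * 2 * 2 * 2 * 2 * 2)%N !exprM.
have sq (a b c : R) : 0 <= a -> c <= a * a -> a <= b -> c <= b ^+ 2.
  by move=> a0 ca ab; apply: le_trans ca _; rewrite expr2; apply: ler_pM.
apply: (sq (1415/1000)); [lra|lra|].
apply: (sq (1 + 18/100 + 96/(100*100))); [lra|lra|].
apply: (sq (1+9/100+72/(1000*100))); [lra|lra|].
apply: (sq (1+4/100+438/(1000*100))); [lra|lra|].
apply: (sq (1+2/100+196/(1000*100))); [lra|lra|].
apply: (sq (1+1/100+93/(1000*100))); [lra|lra|].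
by have := @expR_ge1Dx R (7/640); lra.
Qed.

Definition logq z : R := ln (1 + z + z ^+ 2 / 2).

Lemma quad_gt0 z : 1 / 2 <= 1 + z + z ^+ 2 / 2.
Proof. have := sqr_ge0 (1 + z); nra. Qed.

(** The second derivative of ln (1 + z + z^2 / 2) is at least -1/4, so that the
    function stays above its tangents up to (z - m)^2 / 8.  With x = 1 + z and
    y = 1 + m, the derivative of the difference has the sign of x - y because
    9 + x^2 + y^2 + x^2 y^2 - 8 x y = (x y - 3)^2 + (x - y)^2. *)
Lemma logq_taylor m : exists K : R, forall z,
  logq m + K * (z - m) - (z - m) ^+ 2 / 8 <= logq z.
Proof.
pose dF z : R := (1 + z) / (1 + z + z ^+ 2 / 2).
exists (dF m) => h.
pose f z : R := logq z + (z - m) ^+ 2 / 8 - dF m * (z - m).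
pose df z : R := dF z + (z - m) / 4 - dF m.
have fd z : is_derive z 1 f (df z).
  have q0 : 0 < 1 + z + z ^+ 2 / 2 by have := quad_gt0 z; lra.
  rewrite /f /logq.
  have dq : is_derive z 1 (fun z => 1 + z + z ^+ 2 / 2) (1 + z).
    by apply: is_derive_eq; rewrite /GRing.scale/=; field.
  have dl : is_derive z 1 logq (dF z).
    have := @is_derive1_comp R (@ln R) (fun z => 1 + z + z ^+ 2 / 2) z _ _ (is_derive1_ln q0) dq.
    by rewrite /dF mulrC.
  rewrite /f; apply: is_derive_eq.
  rewrite /df /GRing.scale/=; field; rewrite ?gt_eqF//.
have dfs z : (0 <= z - m -> 0 <= df z) /\ (z - m <= 0 -> df z <= 0).
  have q0 : 0 < 1 + z + z ^+ 2 / 2 by have := quad_gt0 z; lra.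
  have r0 : 0 < 1 + m + m ^+ 2 / 2 by have := quad_gt0 m; lra.
  have -> : df z = (z - m) * (((1 + z) * (1 + m) - 3) ^+ 2 + (z - m) ^+ 2)
     / (16 * (1 + z + z ^+ 2 / 2) * (1 + m + m ^+ 2 / 2)).
    rewrite /df /dF.
    by field; apply/andP; split; rewrite gt_eqF//; lra.
  set D := 16 * _ * _; have D0 : 0 < D by rewrite !mulr_gt0.
  set N := _ ^+ 2 + _ ^+ 2; have N0 : 0 <= N by rewrite addr_ge0 ?sqr_ge0.
  split=> hz; first by apply: divr_ge0; [exact: mulr_ge0 | exact: ltW].
  by rewrite pmulr_lle0 ?invr_gt0// mulr_le0_ge0.
have fc a b : {within `[a, b], continuous f}.
  by apply: derivable_within_continuous => x _; have [] := fd x.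
have fm : f m = logq m by rewrite /f; ring.
suff : f m <= f h by rewrite fm /f; lra.
have [hm|mh] := leP h m.
  have [c /[!in_itv]/= /andP[c1 c2] e] := MVT_segment hm (fun x _ => fd x) (fc _ _).
  have := (dfs c).2; nra.
have [c /[!in_itv]/= /andP[c1 c2] e] := MVT_segment (ltW mh) (fun x _ => fd x) (fc _ _).
have := (dfs c).1; nra.
Qed.

End LogBounds.

Section Psi.
Variable R : realType.
Implicit Types x y z : R.

Lemma ln2_gt0 : 0 < ln 2 :> R.
Proof. by rewrite ln_gt0// ltr1n. Qed.

Lemma ln_half : ln (1 / 2) = - ln 2 :> R.
Proof. by rewrite mul1r lnV// posrE. Qed.

Lemma psi_nonneg_mono x y : 0 <= x -> x <= y -> psi_nonneg x <= psi_nonneg y.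
Proof.
move=> x0 xy; rewrite /psi_nonneg.
have hq z : z < 1 -> 1 / 2 <= 1 - z + z ^+ 2 / 2.
  by move=> z1; have := sqr_ge0 (1 - z); nra.
case: (leP 1 x) => x1; case: (leP 1 y) => y1 //.
- lra.
- by rewrite lerNl -ln_half ler_ln ?posrE ?hq//; have := hq _ x1; lra.
- rewrite lerN2 ler_ln ?posrE; [nra| |].
    by have := hq _ y1; lra.
  by have := hq _ x1; lra.
Qed.

Lemma psi_nonneg_ge0 x : 0 <= x -> 0 <= psi_nonneg x.
Proof.
move=> x0; apply: le_trans (psi_nonneg_mono (lexx 0) x0).
by rewrite /psi_nonneg ler10 subr0 expr0n/= mul0r addr0 ln1 oppr0.
Qed.

Lemma psi_nonneg_le x : 0 <= x -> psi_nonneg x <= ln 2.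
Proof.
move=> x0; have [x1|x1] := leP 1 x; first by rewrite /psi_nonneg x1.
by apply: le_trans (psi_nonneg_mono x0 (ltW x1)) _; rewrite /psi_nonneg lexx.
Qed.

Lemma psi_nonneg0 : psi_nonneg 0 = 0 :> R.
Proof. by rewrite /psi_nonneg ler10 subr0 expr0n/= mul0r addr0 ln1 oppr0. Qed.

Lemma psiN x : psi (- x) = - psi x.
Proof.
rewrite /psi oppr_ge0 opprK; case: ltgtP => [x0|x0|->]; rewrite ?opprK//.
by rewrite oppr0 psi_nonneg0 oppr0.
Qed.

Lemma psi_mono x y : x <= y -> psi x <= psi y.
Proof.
move=> xy; rewrite /psi.
case: (leP 0 x) => x0; case: (leP 0 y) => y0.
- exact: psi_nonneg_mono.
- lra.
- have h1 := psi_nonneg_ge0 y0.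
  have h2 : 0 <= psi_nonneg (- x) by apply: psi_nonneg_ge0; lra.
  lra.
- by rewrite lerN2 psi_nonneg_mono ?lerN2// oppr_ge0 ltW.
Qed.

Lemma psi_le_ln2 x : psi x <= ln 2.
Proof.
rewrite /psi; case: (leP 0 x) => x0; first exact: psi_nonneg_le.
have : 0 <= psi_nonneg (- x) by apply: psi_nonneg_ge0; lra.
have := ln2_gt0; lra.
Qed.

Lemma psi_le_m1 x : x <= -1 -> psi x = - ln 2.
Proof.
move=> x1; rewrite /psi /psi_nonneg.
by rewrite leNgt ifN ?ifT//; [lra | rewrite negbK; lra].
Qed.

(** For 0 <= x <= 1 this is (1 - x + x^2/2) (1 + x + x^2/2) = 1 + x^4/4 >= 1; for
    x in [-1, 0] the two sides agree. *)
Lemma psi_le_logq x : psi x <= logq x.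
Proof.
rewrite /logq; have q0 := quad_gt0 x.
have hq z : z < 1 -> 1 / 2 <= 1 - z + z ^+ 2 / 2.
  by move=> z1; have := sqr_ge0 (1 - z); nra.
rewrite /psi /psi_nonneg; case: (leP 0 x) => x0.
  case: (leP 1 x) => x1.
    by rewrite ler_ln ?posrE//; nra.
  have := hq _ x1 => h.
  rewrite -lnV ?posrE; last lra.
  rewrite ler_ln ?posrE ?invr_gt0; [|lra|lra].
  rewrite -div1r ler_pdivrMr; last lra.
  by have := sqr_ge0 (x ^+ 2); nra.
case: (leP 1 (- x)) => x1.
  by rewrite -ln_half ler_ln ?posrE//; lra.
by rewrite opprK sqrrN opprK.
Qed.

(** The correction put inside the logarithm to make up for the concavity of psi; p is
    the variance scale of the perturbation and t the perturbed squared form.  The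
    coefficients 60 and 600 are generous: they fit in the constants 6.81 and 20 of
    the theorem. *)
Definition slack (p t : R) : R := 60 * p * t + 600 * p ^+ 2.

Lemma slack_ge p t : 0 <= 60 * p * t -> 0 <= slack p t.
Proof.
move=> h; apply: addr_ge0; first exact: h.
apply: mulr_ge0; [exact: ler0n|exact: sqr_ge0].
Qed.

(** A stands for 1 + h + h^2 / 2 at a point with |h| <= t + 2.05.  From
    ln (1 + S / A) >= S / (A + S) it remains to see that
    (3 - 0.54 t) (t^2 / 2 + 6.05 t + 6.66) <= 60 for t >= 0. *)
Lemma ln_slack_gain p t A : 0 <= p -> p < 1 / 20 -> 0 <= t -> 1 / 2 <= A ->
  A <= 1 + (t + 205/100) + (t + 205/100) ^+ 2 / 2 ->
  p * (3 * t - 54/100 * t ^+ 2) <= ln (1 + slack p t / A).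
Proof.
move=> p0 p1 t0 a0 Ale.
have p2 : p ^+ 2 <= p * (1 / 20) by rewrite expr2; apply: ler_wpM2l => //; exact: ltW.
have pt : p * t <= 1 / 20 * t by apply: ler_wpM2r => //; exact: ltW.
have pt0 : 0 <= p * t by exact: mulr_ge0.
have Sg : 60 * p * t <= slack p t by rewrite /slack; have := sqr_ge0 p; lra.
have Sle : slack p t <= 3 * t + 3/2 by rewrite /slack; lra.
have S00 : 0 <= slack p t by lra.
apply: le_trans (ln_ge_1subV _); last first.
  by apply: ltr_pwDl => //; rewrite divr_ge0//; lra.
have -> : 1 - (1 + slack p t / A)^-1 = slack p t / (A + slack p t) by field; lra.
rewrite ler_pdivlMr; last lra.
apply: le_trans Sg.
have q1 : (3 - 54/100 * t) * (A + slack p t) <= 60.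
  have [tb|tb] := leP (3 - 54/100 * t) 0; first by nra.
  apply: (@le_trans _ _ ((3 - 54/100 * t) * (t^+2 / 2 + 605/100 * t + 666/100))).
    apply: ler_wpM2l; first lra.
    clear - Ale Sle; lra.
  have h1 : 0 <= t * t ^+ 2 by rewrite mulr_ge0// sqr_ge0.
  have h2 := sqr_ge0 (t - 4).
  clear - tb h1 h2; lra.
have -> : p * (3 * t - 54 / 100 * t ^+ 2) * (A + slack p t) =
  (p * t) * ((3 - 54/100 * t) * (A + slack p t)) by ring.
have -> : 60 * p * t = (p * t) * 60 by ring.
exact: ler_wpM2l.
Qed.

Lemma ln_five_halves : ln 2 + 1 / 5 <= ln (5 / 2) :> R.
Proof.
have -> : 5 / 2 = 2 * (5 / 4) :> R by lra.
have h : 1 / 5 <= ln (5 / 4) :> R by apply: le_trans (ln_ge_1subV _); lra.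
by rewrite lnM ?posrE//; lra.
Qed.

(** ln (1 + m + m^2 / 2) = ln (5/2) + ln (A / (5/2)) >= ln (5/2) + 1 - (5/2) / A. *)
Lemma logq_ge_linear (m : R) : 1 <= m -> m <= 10 ->
  ln 2 + (m / 20 + 102 / 1000) <= logq m.
Proof.
move=> m1 m2.
have q0 : 0 < 1 + m + m ^+ 2 / 2 by have := quad_gt0 m; lra.
have -> : logq m = ln (5 / 2) + ln ((1 + m + m ^+ 2 / 2) / (5 / 2)).
  by rewrite /logq -lnM ?posrE//; [congr ln; field | lra].
have h1 : 1 - (5 / 2) / (1 + m + m ^+ 2 / 2) <= ln ((1 + m + m ^+ 2 / 2) / (5 / 2)).
  by apply: le_trans (ln_ge_1subV _); [rewrite invf_div|lra].
have h2 : (5 / 2) / (1 + m + m ^+ 2 / 2) <= 1098 / 1000 - 5 / 100 * m.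
  rewrite ler_pdivrMr//; clear h1 q0.
  have e1 : 0 <= (m - 1) * (m - 1) by rewrite -expr2 sqr_ge0.
  have e0 : 0 <= (m - 1) * (m - 1) * (10 - m) by apply: mulr_ge0; rewrite ?subr_ge0.
  lra.
have := ln_five_halves; lra.
Qed.

(** A Chebyshev-type bound: for z >= 1 the left side is at most ln (5/2), and for z < 1
    the parabola has dropped below - ln 2.  Its curvature 1 / m^2 suits variances that
    grow linearly in m. *)
Lemma logq_ge_parabola (m z : R) : 10 < m ->
  ln 2 + 1 / 5 - 2 / m ^+ 2 * (z - m) ^+ 2 <= logq z.
Proof.
move=> m10; have m20 : 0 < m ^+ 2 by rewrite exprn_gt0//; lra.
have qz := quad_gt0 z.
have [hh|hh] := leP 1 z.
  have : 0 <= 2 / m ^+ 2 * (z - m) ^+ 2.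
    by rewrite mulr_ge0 ?sqr_ge0// divr_ge0// ltW.
  have : ln (5 / 2) <= logq z by rewrite /logq ler_ln ?posrE; nra.
  have := ln_five_halves; lra.
have : 162 / 100 <= 2 / m ^+ 2 * (z - m) ^+ 2.
  rewrite mulrAC ler_pdivlMr//.
  have h : 0 <= 9 / 10 * m by lra.
  have : (9 / 10 * m) ^+ 2 <= (m - z) ^+ 2 by rewrite ler_pXn2r ?nnegrE//; lra.
  lra.
have : - ln 2 <= logq z by rewrite -ln_half /logq ler_ln ?posrE//; lra.
have := ln2_le R; lra.
Qed.

(** If D has mean 0 and variance at most 8 x p + 6 p^2, taking means gives
    psi (sg (x - lam)) <= E ln (1 + sg h + h^2 / 2 + slack) with h = x - lam + D:
    a Jensen inequality although psi is not convex.  It is stated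
    through a parabola lying below the logarithm so that only the first two moments
    of D matter. *)
Lemma reverse_jensen_pointwise (sg lam x p : R) :
  sg ^+ 2 = 1 -> 0 <= lam <= 2 -> 0 <= x -> 0 <= p ->
  exists K1 K2 : R, 0 <= K2 /\ forall D, - (x + p) <= D ->
    psi (sg * (x - lam)) + K2 * (8 * x * p + 6 * p ^+ 2) + K1 * D - K2 * D ^+ 2
    <= ln (1 + sg * (x - lam + D) + (x - lam + D) ^+ 2 / 2 + slack p (x + p + D)).
Proof.
move=> sg2 /andP[lam0 lam2] x0 p0.
have sg1 : (sg == 1) || (sg == -1) by rewrite -sqrf_eq1 sg2.
have sqE z : z ^+ 2 = (sg * z) ^+ 2 by rewrite exprMn sg2 mul1r.
have S0 D : - (x + p) <= D -> 0 <= slack p (x + p + D).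
  move=> hD; apply: slack_ge; apply: mulr_ge0; first exact: mulr_ge0.
  by rewrite -lerBlDl sub0r.
have A0 D : 1 / 2 <= 1 + sg * (x - lam + D) + (x - lam + D) ^+ 2 / 2.
  by rewrite [(x - lam + D) ^+ 2]sqE; exact: quad_gt0.
have base D : - (x + p) <= D -> logq (sg * (x - lam + D)) <=
    ln (1 + sg * (x - lam + D) + (x - lam + D) ^+ 2 / 2 + slack p (x + p + D)).
  move=> hD; have a0 := A0 D; have s0 := S0 D hD.
  by rewrite /logq -sqE ler_ln ?posrE ?lerDl//; lra.
(* 600 p^2 >= 3/2 makes the argument of the logarithm at least 2 *)
have [pbig|psmall] := leP (1 / 20) p.
  exists 0, 0; split=> // D hD; rewrite !mul0r subr0 !addr0.
  apply: le_trans (psi_le_ln2 _) _.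
  have a0 := A0 D; set A := 1 + _ + _ in a0 *.
  have s1 : 3 / 2 <= slack p (x + p + D).
    rewrite /slack; have : 0 <= 60 * p * (x + p + D).
      by apply: mulr_ge0; [exact: mulr_ge0|rewrite -lerBlDl sub0r].
    clear - pbig; nra.
  by rewrite ler_ln ?posrE//; lra.
(* psi takes its least value - ln 2, and the argument is at least 1/2 *)
have [mneg|mneg] := leP (sg * (x - lam)) (-1).
  exists 0, 0; split=> // D hD; rewrite !mul0r subr0 !addr0.
  have a0 := A0 D; have s0 := S0 D hD.
  by rewrite psi_le_m1// -ln_half ler_ln ?posrE//; lra.
(* the curvature loss D^2 / 8 is paid by ln (1 + slack / A) *)
have [xle|xgt] := leP x 3.
  have [K hK] := logq_taylor (sg * (x - lam)).
  exists (K * sg + p * (3 - 108/100 * (x + p))), (1 / 8 + 54/100 * p).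
  split; first by clear - p0; lra.
  move=> D hD.
  have := hK (sg * (x - lam + D)).
  have -> : sg * (x - lam + D) - sg * (x - lam) = sg * D by ring.
  rewrite -[(sg * D) ^+ 2]sqE => hT.
  have hpsi := psi_le_logq (sg * (x - lam)).
  set t := x + p + D.
  have t0 : 0 <= t by rewrite /t -lerBlDl sub0r.
  have a0 := A0 D; have s0 := S0 D hD; rewrite -/t in s0.
  have -> : ln (1 + sg * (x - lam + D) + (x - lam + D) ^+ 2 / 2 + slack p t) =
      logq (sg * (x - lam + D)) +
      ln (1 + slack p t / (1 + sg * (x - lam + D) + (x - lam + D) ^+ 2 / 2)).
    set A := 1 + _ + _ in a0 *; have A1 : 0 < A by apply: lt_le_trans a0.
    rewrite /logq -sqE -/A -lnM ?posrE//; first by congr ln; field; rewrite gt_eqF.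
    by apply: ltr_pwDl => //; exact: divr_ge0 s0 (ltW A1).
  have gain : p * (3 * t - 54/100 * t ^+ 2) <= ln (1 + slack p t /
      (1 + sg * (x - lam + D) + (x - lam + D) ^+ 2 / 2)).
    apply: ln_slack_gain => //; apply: lerD.
      rewrite lerD2l; case/orP: sg1 => /eqP ->; rewrite /t; clear - x0 p0 psmall lam0 lam2 hD; lra.
    rewrite ler_pM2r; last by rewrite invr_gt0.
    rewrite -subr_ge0 subr_sqr; apply: mulr_ge0; rewrite /t;
      clear - x0 p0 psmall lam0 lam2 hD; lra.
  have cost : (1 / 8 + 54/100 * p) * (8 * x * p + 6 * p ^+ 2) <=
     p * (3 * (x + p) - 54/100 * (x + p) ^+ 2).
    have -> : (1 / 8 + 54/100 * p) * (8 * x * p + 6 * p ^+ 2) =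
       p * ((1 / 8 + 54/100 * p) * (8 * x + 6 * p)) by ring.
    by apply: ler_wpM2l => //; clear - x0 xle p0 psmall; nra.
  have tE : p * (3 * t - 54/100 * t ^+ 2) = p * (3 * (x + p) - 54/100 * (x + p) ^+ 2) +
     p * (3 - 108/100 * (x + p)) * D - 54/100 * p * D ^+ 2 by rewrite /t; ring.
  rewrite tE in gain; clear - gain cost hT hpsi; lra.
have {}sg1 : sg = 1.
  by case/orP: sg1 => /eqP // e; move: mneg; rewrite e; clear - lam2 xgt; lra.
rewrite {}sg1 in base *; rewrite mul1r.
set m := x - lam in base *; have m1 : 1 < m by rewrite /m; clear - lam2 xgt; lra.
have Vle : 8 * x * p + 6 * p ^+ 2 <= 4 / 10 * (m + 2) + 15 / 1000.
  have : x <= m + 2 by rewrite /m; clear - lam2; lra.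
  by clear - x0 p0 psmall; nra.
have hp := psi_le_ln2 m.
(* psi m = ln 2 is now below ln (1 + m + m^2 / 2) by more than the loss *)
have [mle|mgt] := leP m 10.
  have [K hK] := logq_taylor m.
  exists K, (1 / 8); split; first by rewrite divr_ge0.
  move=> D hD; apply: le_trans (base _ hD); rewrite !mul1r.
  apply: le_trans (hK _).
  have -> : m + D - m = D by ring.
  have hl := logq_ge_linear (ltW m1) mle.
  clear - hp hl Vle; lra.
exists 0, (2 / m ^+ 2).
have m20 : 0 < m ^+ 2 by rewrite exprn_gt0//; exact: lt_trans m1.
split; first by apply: divr_ge0 => //; exact: ltW.
move=> D hD; apply: le_trans (base _ hD); rewrite !mul1r mul0r addr0.
have KV : 2 / m ^+ 2 * (8 * x * p + 6 * p ^+ 2) <= 1 / 5.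
  by rewrite mulrAC ler_pdivrMr//; clear - Vle mgt; nra.
have hl := @logq_ge_parabola m (m + D) mgt.
rewrite (_ : m + D - m = D) in hl; last by ring.
clear - hp hl KV; lra.
Qed.
End Psi.

(** * Spline perturbations on a grid *)

Section Perturbation.
Variable R : realType.
Implicit Types (x y z t a : R) (zs ys : seq R) (ks : seq int).

(** The abstract properties of averaging, shared by the one-dimensional spline laws
    and by their products. *)
Definition expectation_op (S : Type) (E : (S -> R) -> R) :=
  [/\ forall a f g, E (fun s => a * f s + g s) = a * E f + E g,
      forall f g, (forall s, f s <= g s) -> E f <= E g &
      E (fun=> 1) = 1].

Section OpTheory.
Variables (S : Type) (E : (S -> R) -> R).
Hypothesis EP : expectation_op E.

Lemma opD f g : E (fun s => f s + g s) = E f + E g.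
Proof.
have [lin _ _] := EP; rewrite -[E f]mul1r -lin; congr E.
by apply/funext => s; rewrite mul1r.
Qed.

Lemma op0 : E (fun=> 0) = 0.
Proof.
have := opD (fun=> 0) (fun=> 0).
have -> : (fun s : S => 0 + 0 : R) = fun=> 0 by apply/funext => s; rewrite addr0.
by lra.
Qed.

Lemma opZ a f : E (fun s => a * f s) = a * E f.
Proof.
have [lin _ _] := EP; rewrite -[RHS]addr0 -op0 -lin; congr E.
by apply/funext => s; rewrite addr0.
Qed.

Lemma op_cst a : E (fun=> a) = a.
Proof.
have [_ _ E1] := EP; rewrite -[RHS]mulr1 -E1 -opZ; congr E.
by apply/funext => s; rewrite mulr1.
Qed.

Lemma op_le f g : (forall s, f s <= g s) -> E f <= E g.
Proof. by have [_ + _] := EP; apply. Qed.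

Lemma op_affine c al be f g :
  E (fun s => c + (al * f s + be * g s)) = c + (al * E f + be * E g).
Proof. by rewrite (opD (fun=> c)) op_cst opD !opZ. Qed.

Lemma op_sum n (F : 'I_n -> S -> R) :
  E (fun s => \sum_(i < n) F i s) = \sum_(i < n) E (F i).
Proof.
elim: n F => [|n IH] F.
  rewrite big_ord0 -[RHS]op0; congr E; apply/funext => s; by rewrite big_ord0.
rewrite big_ord_recr/= -IH -opD; congr E; apply/funext => s.
by rewrite big_ord_recr.
Qed.

End OpTheory.

Definition near_int (z : R) : int := Num.floor (z + 1 / 2).

(** Averaging with respect to the quadratic B-spline weights at the three integers
    closest to z.  They sum to 1 and reproduce polynomials of degree 1, and their
    variance 1/4 does not depend on z: the bias of a squared form under perturbation
    is then the same for all centers and can be subtracted. *)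
Definition spline_op (z : R) (f : int -> R) : R :=
  let k := near_int z in let t := z - k%:~R in
  (1 / 2 - t) ^+ 2 / 2 * f (k - 1) + (3 / 4 - t ^+ 2) * f k +
  (1 / 2 + t) ^+ 2 / 2 * f (k + 1).

Lemma near_int_itv z : - (1 / 2) <= z - (near_int z)%:~R <= 1 / 2.
Proof.
have := floor_le (z + 1/2); have := floorD1_gt (z + 1/2).
rewrite /near_int intrD; lra.
Qed.

Lemma spline_opP z : expectation_op (spline_op z).
Proof.
have := near_int_itv z; rewrite /spline_op.
set k := near_int z; set t := z - _ => /andP[t1 t2].
split=> [a f g|f g fg|]; [ring| |lra].
have w3 : 0 <= 3 / 4 - t ^+ 2 by nra.
by apply: lerD; first apply: lerD; apply: ler_wpM2l => //; apply: divr_ge0 => //;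
  exact: sqr_ge0.
Qed.

Lemma spline_mean z : spline_op z (fun k => k%:~R - z) = 0.
Proof.
rewrite /spline_op !(intrD, intrN).
set k := (near_int z)%:~R; by field.
Qed.

Lemma spline_var z : spline_op z (fun k => (k%:~R - z) ^+ 2) = 1 / 4.
Proof.
rewrite /spline_op !(intrD, intrN).
set k := (near_int z)%:~R; by field.
Qed.

(** With t = z - near_int z the moment is 1/4 - (3/2) t^2 + 3 t^4 and t^2 <= 1/4. *)
Lemma spline_mom4 z : spline_op z (fun k => (k%:~R - z) ^+ 4) <= 1 / 4.
Proof.
have := near_int_itv z; rewrite /spline_op !(intrD, intrN).
set k := (near_int z)%:~R => /andP[t1 t2].
set t := z - k in t1 t2 *.
have -> : k + - 1%:~R - z = - 1 - t by rewrite /t; ring.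
have -> : k + 1%:~R - z = 1 - t by rewrite /t; ring.
have -> : k - z = - t by rewrite /t; ring.
have t4 : t ^+ 2 <= 1 / 4 by nra.
have -> : (1 / 2 - t) ^+ 2 / 2 * (-1 - t) ^+ 4 + (3 / 4 - t ^+ 2) * (- t) ^+ 4 +
   (1 / 2 + t) ^+ 2 / 2 * (1 - t) ^+ 4 = 1 / 4 - 3 / 2 * t ^+ 2 + 3 * t ^+ 4.
  by field.
have -> : t ^+ 4 = t ^+ 2 * t ^+ 2 by ring.
have := sqr_ge0 t; nra.
Qed.

Fixpoint dots (us vs : seq R) : R :=
  match us, vs with
  | u :: us', v :: vs' => u * v + dots us' vs'
  | _, _ => 0
  end.

(** The product of the spline laws with centers zs, written as nested averages so
    that its properties follow by induction on the list of centers. *)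
Fixpoint grid_op (zs : seq R) (f : seq int -> R) : R :=
  match zs with
  | [::] => f [::]
  | z :: zs' => spline_op z (fun k => grid_op zs' (fun ks => f (k :: ks)))
  end.

Lemma grid_opP zs : expectation_op (grid_op zs).
Proof.
elim: zs => [|z zs [L M C]] /=; first by split.
have [l m c] := spline_opP z; split=> [a f g|f g fg|].
- by rewrite -l; congr spline_op; apply/funext => k; rewrite L.
- by apply: m => k; apply: M => ks; apply: fg.
- by rewrite -[RHS]c; congr spline_op; apply/funext => k; exact: C.
Qed.

Definition grid_dev zs ys ks : R := dots ys (map intr ks) - dots ys zs.

Lemma grid_dev_cons z zs y ys k ks :
  grid_dev (z :: zs) (y :: ys) (k :: ks) = y * (k%:~R - z) + grid_dev zs ys ks.
Proof. by rewrite /grid_dev/=; ring. Qed.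

(** Third moments do not vanish, but in the induction they only meet the factor
    E (k - z) = 0.  The fourth moment constant is 4 rather than the 3 of a Gaussian
    because the spline law centered at an integer has kurtosis 4. *)
Lemma grid_moments zs ys : size ys = size zs ->
  let q := dots ys ys / 4 in
  [/\ grid_op zs (grid_dev zs ys) = 0,
      grid_op zs (fun ks => grid_dev zs ys ks ^+ 2) = q &
      grid_op zs (fun ks => grid_dev zs ys ks ^+ 4) <= 4 * q ^+ 2].
Proof.
elim: zs ys => [|z zs IH] [|y ys]//= sz.
  by rewrite /grid_dev /= subrr !expr0n/= mul0r expr0n/= mulr0.
have [|] := IH ys; first by case: sz.
set q := dots ys ys / 4 => m1 m2 m4.
have P := grid_opP zs; have p := spline_opP z.
set A := fun k : int => y * (k%:~R - z).
set B := grid_dev zs ys in m1 m2 m4 *.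
have e1 k : grid_op zs (fun ks => grid_dev (z :: zs) (y :: ys) (k :: ks)) = A k.
  under eq_fun do rewrite grid_dev_cons.
  by rewrite (opD P) (op_cst P) m1 addr0.
have e2 k : grid_op zs (fun ks => grid_dev (z :: zs) (y :: ys) (k :: ks) ^+ 2)
    = y ^+ 2 * (k%:~R - z) ^+ 2 + q.
  rewrite -m2 -[y ^+ 2 * _](op_cst P) -[RHS]addr0 -[0](mulr0 (2 * A k)) -m1.
  rewrite -(opZ P) -!(opD P); congr grid_op; apply/funext => ks.
  by rewrite grid_dev_cons /A /B; ring.
have [c e4] : exists c, forall k,
    grid_op zs (fun ks => grid_dev (z :: zs) (y :: ys) (k :: ks) ^+ 4)
    <= y ^+ 4 * (k%:~R - z) ^+ 4 + (6 * y ^+ 2 * q * (k%:~R - z) ^+ 2 +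
      (4 * y * c * (k%:~R - z) + 4 * q ^+ 2)).
  exists (grid_op zs (fun ks => B ks ^+ 3)) => k.
  apply: (@le_trans _ _ (A k ^+ 4 + (4 * A k ^+ 3 * 0 + (6 * A k ^+ 2 * q +
    (4 * A k * grid_op zs (fun ks => B ks ^+ 3) +
      grid_op zs (fun ks => B ks ^+ 4)))))); last first.
    by rewrite /A; move: m4; lra.
  rewrite -m1 -m2 -!(opZ P) -!(opD P) -[A k ^+ 4](op_cst P) -(opD P).
  by apply: (op_le P) => ks; rewrite grid_dev_cons -/(A k) -/(B ks); lra.
split.
- under eq_fun do rewrite e1.
  by rewrite /A (opZ p) spline_mean mulr0.
- under eq_fun do rewrite e2.
  by rewrite (opD p) (opZ p) spline_var (op_cst p) /q; by field.
- apply: le_trans (op_le p e4) _.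
  rewrite (opD p) (opD p) (opD p) !(opZ p) spline_var spline_mean (op_cst p).
  have h4 := spline_mom4 z.
  have -> : ((y * y + dots ys ys) / 4) = y ^+ 2 / 4 + q by rewrite /q; by field.
  have q0 : 0 <= q.
    by rewrite -m2 -(op0 P); apply: (op_le P) => ks; exact: sqr_ge0.
  have -> : y ^+ 4 = y ^+ 2 * y ^+ 2 by ring.
  set m := spline_op z _ in h4 *; set Y := y ^+ 2.
  have Y0 : 0 <= Y by exact: sqr_ge0.
  have hY : Y * Y * m <= Y * Y * (1 / 4) by apply: ler_wpM2l => //; exact: mulr_ge0.
  have Yq : 0 <= Y * q by exact: mulr_ge0.
  rewrite -/q. lra.
Qed.

(** The factor whose logarithm dominates psi once averaged over the perturbation.  The
    mean P of the squared deviation is subtracted from a^2, which makes the argument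
    of the quadratic unbiased. *)
Definition perturbed_factor (sg lam P a : R) : R :=
  1 + sg * (lam * (a ^+ 2 - P - 1)) + (lam * (a ^+ 2 - P - 1)) ^+ 2 / 2 +
  slack (lam * P) (lam * a ^+ 2).

Section Smoothing.
Variables (S : Type) (E : (S -> R) -> R) (EP : expectation_op E).
Variables (b : S -> R) (P : R).
Hypotheses (b1 : E b = 0) (b2 : E (fun s => b s ^+ 2) = P)
  (b4 : E (fun s => b s ^+ 4) <= 4 * P ^+ 2).

Let P0 : 0 <= P.
Proof. by rewrite -b2 -(op0 EP); apply: (op_le EP) => s; exact: sqr_ge0. Qed.

Let D lam a s : R := lam * (2 * a * b s + b s ^+ 2 - P).

Let ED lam a : E (D lam a) = 0.
Proof.
have -> : D lam a = fun s => lam * 2 * a * b s + (lam * b s ^+ 2 + - (lam * P)).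
  by apply/funext => s; rewrite /D; ring.
by rewrite (opD EP) (opD EP) !(opZ EP) b1 b2 (op_cst EP); ring.
Qed.

Let ED2 lam a : 0 <= lam ->
  E (fun s => D lam a s ^+ 2) <= 8 * (lam * a ^+ 2) * (lam * P) + 6 * (lam * P) ^+ 2.
Proof.
move=> lam0.
apply: (@le_trans _ _ (E (fun s => lam ^+ 2 * (8 * a ^+ 2) * b s ^+ 2 +
   (2 * lam ^+ 2 * b s ^+ 4 +
   (- (4 * lam ^+ 2 * P) * b s ^+ 2 + 2 * lam ^+ 2 * P ^+ 2))))).
  apply: (op_le EP) => s; rewrite /D.
  have -> : lam ^+ 2 * (8 * a ^+ 2) * b s ^+ 2 + (2 * lam ^+ 2 * b s ^+ 4 +
     (- (4 * lam ^+ 2 * P) * b s ^+ 2 + 2 * lam ^+ 2 * P ^+ 2)) =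
     (lam * (2 * a * b s + b s ^+ 2 - P)) ^+ 2 +
     (lam * (2 * a * b s - (b s ^+ 2 - P))) ^+ 2 by ring.
  by rewrite lerDl sqr_ge0.
rewrite (opD EP) (opD EP) (opD EP) !(opZ EP) (op_cst EP) b2.
have : 2 * lam ^+ 2 * E (fun s => b s ^+ 4) <= 2 * lam ^+ 2 * (4 * P ^+ 2).
  by apply: ler_wpM2l => //; rewrite mulr_ge0 ?sqr_ge0.
lra.
Qed.

(** [reverse_jensen_pointwise] with x = lam a^2, p = lam P and
    D = lam (2 a b + b^2 - P). *)
Lemma psi_le_smoothed (sg lam a : R) : sg ^+ 2 = 1 -> 0 <= lam <= 2 ->
  psi (sg * (lam * (a ^+ 2 - 1))) <=
  E (fun s => ln (perturbed_factor sg lam P (a + b s))).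
Proof.
move=> sg2 lamb; have /andP[lam0 _] := lamb.
have x0 : 0 <= lam * a ^+ 2 by rewrite mulr_ge0 ?sqr_ge0.
have p0 : 0 <= lam * P by exact: mulr_ge0.
have [K1 [K2 [K20 hK]]] := reverse_jensen_pointwise sg2 lamb x0 p0.
set V := 8 * _ * _ + _ in hK.
apply: (@le_trans _ _ (E (fun s => (psi (sg * (lam * a ^+ 2 - lam)) + K2 * V) +
   (K1 * D lam a s + - K2 * D lam a s ^+ 2)))).
  rewrite (op_affine EP _ _ _ (D lam a)) ED.
  have := ED2 a lam0; rewrite -/V => h.
  have -> : lam * (a ^+ 2 - 1) = lam * a ^+ 2 - lam by ring.
  have := ler_wpM2l K20 h; lra.
apply: (op_le EP) => s.
have xD : lam * a ^+ 2 + lam * P + D lam a s = lam * (a + b s) ^+ 2.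
  by rewrite /D; ring.
have mD : lam * a ^+ 2 - lam + D lam a s = lam * ((a + b s) ^+ 2 - P - 1).
  by rewrite /D; ring.
have hD : - (lam * a ^+ 2 + lam * P) <= D lam a s.
  have : 0 <= lam * (a + b s) ^+ 2 by rewrite mulr_ge0 ?sqr_ge0.
  by rewrite -xD; lra.
have := hK _ hD; rewrite xD mD => h.
by apply: le_trans h; lra.
Qed.

Lemma smoothed_mean_le (sg lam a : R) : 0 <= lam ->
  let m := lam * (a ^+ 2 - 1) in
  E (fun s => perturbed_factor sg lam P (a + b s)) <=
  1 + sg * m + m ^+ 2 / 2 + 64 * lam ^+ 2 * a ^+ 2 * P + 663 * lam ^+ 2 * P ^+ 2.
Proof.
move=> lam0; set m := lam * (a ^+ 2 - 1); rewrite /=.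
have -> : (fun s => perturbed_factor sg lam P (a + b s)) = (fun s =>
   (1 + sg * m + m ^+ 2 / 2 + 60 * lam ^+ 2 * P * (a ^+ 2 + P) + 600 * lam ^+ 2 * P ^+ 2)
   + ((sg + m + 60 * lam * P) * D lam a s + 1 / 2 * D lam a s ^+ 2)).
  by apply/funext => s; rewrite /perturbed_factor /slack /D /m; by field.
rewrite (op_affine EP _ _ _ (D lam a)) ED.
by have := ED2 a lam0; lra.
Qed.

End Smoothing.
End Perturbation.

(** * Relative entropy with respect to a geometric prior *)

Section Prior.
Variable R : realType.
Implicit Types (x y z t a : R) (zs ys : seq R) (ks : seq int) (k : int) (M r : nat).

(** The integers of absolute value at most M, enumerated so that the window of size
    M + 1 extends the one of size M by two points. *)
Fixpoint int_window M : seq int :=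
  if M is M'.+1 then M'.+1%:Z :: - M'.+1%:Z :: int_window M' else [:: 0].

Lemma mem_int_window M k : (k \in int_window M) = (`|k| <= M)%N.
Proof.
elim: M => [|M IH]/=.
  by rewrite inE leqn0 absz_eq0.
by rewrite !inE IH; lia.
Qed.

Lemma uniq_int_window M : uniq (int_window M).
Proof.
elim: M => [|M IH] //=.
rewrite IH inE !mem_int_window; lia.
Qed.

(** A two-sided geometric law: 2/5 + 2 (1/5) (1 + 1/3 + 1/9 + ...) = 1. *)
Definition prior_weight k : R :=
  if k == 0 then 2 / 5 else 3 / 5 * (1 / 3) ^+ `|k|%N.

Lemma prior_weight_gt0 k : 0 < prior_weight k.
Proof.
rewrite /prior_weight; case: ifP => _; first lra.
by rewrite mulr_gt0// exprn_gt0.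
Qed.

Lemma prior_mass_le1 M : \sum_(k <- int_window M) prior_weight k <= 1.
Proof.
suff -> : \sum_(k <- int_window M) prior_weight k = 1 - 3 / 5 * (1 / 3) ^+ M.
  by rewrite gerBl mulr_ge0// exprn_ge0.
elim: M => [|M IH]/=.
  by rewrite big_seq1 /prior_weight eqxx expr0; lra.
rewrite !big_cons IH /prior_weight/= exprS; lra.
Qed.

(** A quadratic bound, because the second moment z^2 + 1/4 is what is known exactly
    about the spline law. *)
Lemma prior_weight_ln k : - ln (prior_weight k) <= ln (5 / 2) + 7 / 10 * k%:~R ^+ 2.
Proof.
rewrite /prior_weight; case: eqP => [->|/eqP k0].
  rewrite -lnV ?posrE; last lra.
  by rewrite expr0n/= mulr0 addr0 invf_div.
have e5 : ln (5 / 3) <= ln (5 / 2) :> R by rewrite ler_ln ?posrE; lra.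
have e5' : ln (5 / 3) + ln 3 = ln (5 / 2) + ln 2 :> R.
  by rewrite -!lnM ?posrE; [congr ln; lra|lra..].
have e3 : ln 3 <= 2 * ln 2 :> R.
  have -> : 2 * ln 2 = ln (2 * 2) :> R by rewrite lnM ?posrE//; lra.
  by rewrite ler_ln ?posrE; lra.
have l2 := ln2_le R.
have -> : - ln (3 / 5 * (1 / 3) ^+ `|k|%N) = ln (5 / 3) + `|k|%:R * ln 3 :> R.
  have p1 : 0 < 3 / 5 :> R by lra.
  have p2 : 0 < (1 / 3) ^+ `|k|%N :> R by rewrite exprn_gt0.
  have -> : ln (5 / 3) = - ln (3 / 5) :> R by rewrite -lnV ?posrE// invf_div.
  by rewrite lnM ?posrE// lnXn// -mulr_natl mul1r lnV ?posrE//; ring.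
have -> : k%:~R ^+ 2 = `|k|%:R ^+ 2 :> R.
  by rewrite -natrX -[in LHS]rmorphXn/= -abszX -{1}[k ^+ 2]gez0_abs ?sqr_ge0.
case: `|k|%N (absz_eq0 k) => [|[|j]].
- by rewrite eqxx (negbTE k0).
- by move=> _; rewrite mul1r expr1n; lra.
move=> _; have j0 : 0 <= j%:R :> R by [].
have e : j.+2%:R = j%:R + 2 :> R by rewrite -[in LHS]addn2 natrD.
rewrite e.
have h : (j%:R + 2) * ln 3 <= (j%:R + 2) * (7 / 5) :> R.
  by apply: ler_wpM2l; lra.
have h' : 0 <= j%:R * (j%:R + 2) :> R by rewrite mulr_ge0//; lra.
lra.
Qed.

Definition prior1 M (f : int -> R) : R :=
  \sum_(k <- int_window M) prior_weight k * f k.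

Fixpoint prior_op M r (f : seq int -> R) : R :=
  if r is r'.+1 then prior1 M (fun k => prior_op M r' (fun ks => f (k :: ks)))
  else f [::].

Lemma prior1_gt0 M f : (forall k, 0 < f k) -> 0 < prior1 M f.
Proof.
move=> f0; rewrite /prior1; elim: M => [|M IH]/=.
  by rewrite big_seq1 mulr_gt0 ?prior_weight_gt0.
by rewrite !big_cons !addr_gt0 ?mulr_gt0 ?prior_weight_gt0.
Qed.

Lemma prior_op_gt0 M r f : (forall ks, 0 < f ks) -> 0 < prior_op M r f.
Proof.
elim: r f => [|r IH] f f0 //=; apply: prior1_gt0 => k; exact: IH.
Qed.

(** The elementary inequality behind the nonnegativity of relative entropy. *)
Lemma xlnx_le t y : 0 <= t -> 0 < y -> t * (ln y - ln t) <= y - t.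
Proof.
rewrite le_eqVlt => /orP[/eqP<-|t0] y0; first by rewrite mul0r subr0 ltW.
rewrite -ln_div ?posrE//.
have yt : 0 < y / t by rewrite divr_gt0.
apply: le_trans (ler_wpM2l (ltW t0) (ln_le_sub1 yt)) _.
by rewrite mulrBr mulr1 mulrCA divff ?mulr1// gt_eqF.
Qed.

(** The Donsker-Varadhan inequality together with a bound on the relative entropy of
    the spline law: -ln (weight) costs at most ln (5/2) + (7/10) (z^2 + 1/4) in mean,
    and the entropy of the three spline weights gives back at least 13/32. *)
Lemma spline_prior_entropy M z (G : int -> R) : `|z| <= M%:R ->
  spline_op z G <= ln (prior1 M.+1 (fun k => expR (G k))) + 73 / 100 + 7 / 10 * z ^+ 2.
Proof.
move=> zM.
have := near_int_itv z; rewrite /spline_op; set k := near_int z.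
set t := z - k%:~R => /andP[t1 t2].
set Y := prior1 _ _.
have Y0 : 0 < Y by apply: prior1_gt0 => i; exact: expR_gt0.
set q1 := (1 / 2 - t) ^+ 2 / 2; set q2 := 3 / 4 - t ^+ 2; set q3 := (1 / 2 + t) ^+ 2 / 2.
have q10 : 0 <= q1 by rewrite divr_ge0// sqr_ge0.
have q20 : 0 <= q2 by rewrite /q2; nra.
have q30 : 0 <= q3 by rewrite divr_ge0// sqr_ge0.
have kM : (`|k| <= M)%N.
  have zb : - M%:R <= z <= M%:R by rewrite -ler_norml.
  have k1 : k%:~R < (M%:Z + 1)%:~R :> R by rewrite intrD -!pmulrn; rewrite /t in t1 t2; lra.
  have k2 : (- M%:Z - 1)%:~R < k%:~R :> R.
    by rewrite !(intrD, intrN) -!pmulrn; rewrite /t in t1 t2; lra.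
  by move: k1 k2; rewrite !ltr_int; lia.
pose F i := prior_weight i * expR (G i).
have F0 i : 0 < F i by rewrite mulr_gt0 ?prior_weight_gt0 ?expR_gt0.
have le3 : F (k - 1) + F k + F (k + 1) <= Y.
  rewrite /Y /prior1.
  have u := uniq_int_window M.+1; have memL := mem_int_window M.+1.
  move: (int_window M.+1) memL u => L memL u.
  rewrite (big_rem (k - 1))/=; last by rewrite memL; lia.
  have u1 := rem_uniq (k - 1) u.
  rewrite (big_rem k)/=; last first.
    by rewrite mem_rem_uniq// inE/= memL; lia.
  have u2 := rem_uniq k u1.
  rewrite (big_rem (k + 1))/=; last first.
    by rewrite mem_rem_uniq// inE/= mem_rem_uniq// inE/= memL; lia.
  rewrite !addrA lerDl; apply: sumr_ge0 => i _; exact: ltW (F0 i).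
have ent q i : 0 <= q ->
    q * G i <= q * ln Y + q * (q - 1) + q * (ln (5 / 2) + 7 / 10 * i%:~R ^+ 2) +
      (F i / Y - q).
  move=> q0; have y0 : 0 < F i / Y by rewrite divr_gt0.
  have h1 := xlnx_le q0 y0.
  have h2 : q * ln q <= q * (q - 1).
    move: q0; rewrite le_eqVlt => /orP[/eqP<-|q0]; first by rewrite !mul0r.
    by apply: ler_wpM2l; [exact: ltW|exact: ln_le_sub1].
  have h3 := ler_wpM2l q0 (prior_weight_ln i).
  have e : ln (F i / Y) = ln (prior_weight i) + G i - ln Y.
    by rewrite ln_div ?posrE// /F lnM ?posrE ?expRK ?prior_weight_gt0 ?expR_gt0.
  move: h1 h3; rewrite e; lra.
have hF : F (k - 1) / Y + F k / Y + F (k + 1) / Y <= 1.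
  by rewrite -!mulrDl ler_pdivrMr// mul1r.
have qs : q1 + q2 + q3 = 1 by rewrite /q1 /q2 /q3; field.
(* 19 / 32 is the largest possible sum of squares of the three weights *)
have q2s : q1 * (q1 - 1) + q2 * (q2 - 1) + q3 * (q3 - 1) <= 19 / 32 - 1.
  have -> : q1 * (q1 - 1) + q2 * (q2 - 1) + q3 * (q3 - 1) =
    19 / 32 - 1 + 3 / 2 * (t ^+ 2 * (t ^+ 2 - 1 / 2)).
    by rewrite /q1 /q2 /q3; field.
  have t2b : t ^+ 2 <= 1 / 4 by nra.
  have := sqr_ge0 t; nra.
have km : q1 * (k - 1)%:~R ^+ 2 + q2 * k%:~R ^+ 2 + q3 * (k + 1)%:~R ^+ 2 =
    z ^+ 2 + 1 / 4 :> R.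
  by rewrite !(intrD, intrN) /q1 /q2 /q3 /t; field.
have ln25 : ln (5 / 2) <= 95 / 100 :> R.
  have -> : 5 / 2 = 2 * (5 / 4) :> R by lra.
  rewrite lnM ?posrE//; have := @ln_le_sub1 R (5 / 4); have := ln2_le R; lra.
have := ent q1 (k - 1) q10; have := ent q2 k q20; have := ent q3 (k + 1) q30.
have qY : q1 * ln Y + q2 * ln Y + q3 * ln Y = ln Y by rewrite -!mulrDl qs mul1r.
have q5 : q1 * ln (5 / 2) + q2 * ln (5 / 2) + q3 * ln (5 / 2) = ln (5 / 2) :> R.
  by rewrite -!mulrDl qs mul1r.
lra.
Qed.

(** Chain rule for relative entropy: the one-dimensional inequality is applied to the
    logarithm of the exponential mean over the remaining coordinates. *)
Lemma grid_prior_entropy M zs (G : seq int -> R) :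
  all (fun z => `|z| <= M%:R) zs ->
  grid_op zs G <= ln (prior_op M.+1 (size zs) (fun ks => expR (G ks))) +
    73 / 100 * (size zs)%:R + 7 / 10 * dots zs zs.
Proof.
elim: zs G => [|z zs IH] G /=; first by rewrite expRK !mulr0 !addr0.
move=> /andP[zM zsM].
have P := spline_opP z.
pose H k := prior_op M.+1 (size zs) (fun ks => expR (G (k :: ks))).
have H0 k : 0 < H k by apply: prior_op_gt0 => ks; exact: expR_gt0.
apply: (@le_trans _ _ (spline_op z (fun k => ln (H k) +
    (73 / 100 * (size zs)%:R + 7 / 10 * dots zs zs)))).
  by apply: (op_le P) => k; rewrite addrA; exact: IH.
rewrite (opD P (fun k => ln (H k))) (op_cst P).
have := spline_prior_entropy (fun k => ln (H k)) zM.
have -> : (fun k => expR (ln (H k))) = H by apply/funext => k; rewrite lnK ?posrE.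
rewrite -[prior1 _ _]/(prior_op M.+1 (size (z :: zs)) (fun ks => expR (G ks))).
have -> : (size zs).+1%:R = (size zs)%:R + 1 :> R by rewrite -[in LHS]addn1 natrD.
lra.
Qed.
End Prior.

(** * Products of independent variables *)

Lemma measurable_fun_big (R : realType) (d : measure_display) (T : measurableType d)
    (I : Type) (s : seq I) (p : pred I) (f : I -> T -> R) :
  (forall i, measurable_fun setT (f i)) ->
  measurable_fun setT (fun x => \prod_(i <- s | p i) f i x) /\
  measurable_fun setT (fun x => \sum_(i <- s | p i) f i x).
Proof.
move=> mf; elim: s => [|i s [IH1 IH2]].
  by split; under eq_fun do rewrite big_nil; exact: measurable_cst.
by split; under eq_fun do rewrite big_cons; case: (p i) => //;
  [exact: measurable_funM|exact: measurable_funD].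
Qed.

Section Independence.
Context (R : realType) (d d' : measure_display) (T : measurableType d)
  (T' : measurableType d') (P : probability T R) (Q : probability T' R).

Import HBNNSimple.
Local Open Scope ereal_scope.

(** The hypothesis on indicators extends to simple functions by linearity and then
    to nonnegative functions by monotone convergence. *)
Lemma integral_factor (g : T -> R) (Y : T -> T') (c : R) (f : T' -> R) :
  measurable_fun setT g -> (forall w, (0 <= g w)%R) -> (0 <= c)%R ->
  measurable_fun setT Y ->
  (forall A, measurable A -> \int[P]_w (g w * \1_A (Y w))%:E = c%:E * Q A) ->
  measurable_fun setT f -> (forall x, (0 <= f x)%R) ->
  \int[P]_w (g w * f (Y w))%:E = c%:E * \int[Q]_x (f x)%:E.
Proof.
move=> mg g0 c0 mY hA mf f0.
have mfE : measurable_fun [set: T'] (fun x => (f x)%:E) by exact/measurable_EFinP.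
pose h := @nnsfun_approx _ T' R setT measurableT _ mfE.
have f0E x : 0 <= (f x)%:E by rewrite lee_fin.
have hcvg x : EFin \o h^~ x @ \oo --> (f x)%:E.
  by apply: cvg_nnsfun_approx => // y _; exact: f0E.
have mh n : measurable_fun [set: T'] (h n) by [].
have hmono x : {homo (fun n => (h n x)%:E) : a b / (a <= b)%N >-> a <= b}.
  by move=> a b ab; rewrite lee_fin; exact/lefP/nd_nnsfun_approx.
have -> : \int[Q]_x (f x)%:E = lim (\int[Q]_x (h n x)%:E @[n --> \oo]).
  rewrite -monotone_convergence//.
  - by apply: eq_integral => x _; apply/esym/cvg_lim => //; exact: hcvg.
  - by move=> n; exact/measurable_EFinP.
  - by move=> n x _; rewrite lee_fin.
have -> : \int[P]_w (g w * f (Y w))%:E =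
    lim (\int[P]_w (g w * h n (Y w))%:E @[n --> \oo]).
  rewrite -monotone_convergence//.
  - apply: eq_integral => w _; apply/esym/cvg_lim => //.
    under eq_fun do rewrite EFinM.
    by rewrite EFinM; apply: cvgeZl => //; exact: hcvg.
  - move=> n; apply/measurable_EFinP; apply: measurable_funM => //.
    exact: measurableT_comp.
  - by move=> n w _; rewrite lee_fin mulr_ge0.
  - move=> w _ a b ab; rewrite lee_fin ler_wpM2l// -lee_fin.
    exact: hmono.
rewrite -limeMl//; last first.
  apply: ereal_nondecreasing_is_cvgn => a b ab.
  apply: ge0_le_integral => //=; try exact/measurable_EFinP;
    try by move=> x _; rewrite lee_fin.
  by move=> x _; exact: hmono.
suff e : (fun n => \int[P]_w (g w * h n (Y w))%:E) =
    (fun n => c%:E * \int[Q]_x (h n x)%:E) by rewrite e.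
apply/funext => n.
have hE x : (h n x)%:E = \sum_(y \in range (h n)) (y * \1_(h n @^-1` [set y]) x)%:E.
  by rewrite fimfunE -fsumEFin.
have ypos y : y \in range (h n) -> (0 <= y)%R.
  by rewrite inE => -[x _ <-].
have mpre y : measurable (h n @^-1` [set y]) by exact: measurable_funPTI.
transitivity (\sum_(y \in range (h n)) y%:E * (c%:E * Q (h n @^-1` [set y]))); last first.
  under eq_integral do rewrite hE.
  rewrite ge0_integral_fsum//; [|by move=> y; apply/measurable_EFinP; exact: measurable_funM|
    by move=> y x _; exact: nnfun_muleindic_ge0].
  rewrite ge0_mule_fsumr; last by move=> y; apply: integral_ge0 => x _; exact: nnfun_muleindic_ge0.
  apply: eq_fsbigr => y yr.
  under eq_integral do rewrite EFinM.
  rewrite ge0_integralZl_EFin ?ypos//; last exact/measurable_EFinP.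
  by rewrite integral_indic// setIT muleCA.
transitivity (\int[P]_w \sum_(y \in range (h n))
    (y * (g w * \1_(h n @^-1` [set y]) (Y w)))%:E).
  apply: eq_integral => w _; rewrite EFinM hE fsumEFin// -EFinM fsumEFin//.
  congr EFin; rewrite mulr_fsumr//.
  by apply: eq_fsbigr => y _; rewrite mulrCA.
have mgi y : measurable_fun setT (fun w => g w * \1_(h n @^-1` [set y]) (Y w))%R.
  by apply: measurable_funM => //; apply: measurableT_comp.
rewrite ge0_integral_fsum//.
- apply: eq_fsbigr => y yr; rewrite -hA//.
  under eq_integral do rewrite EFinM.
  rewrite ge0_integralZl_EFin ?ypos//.
  - by move=> w _; rewrite lee_fin mulr_ge0.
  - exact/measurable_EFinP.
- by move=> y; apply/measurable_EFinP; exact: measurable_funM.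
- move=> y w _; rewrite mulrCA EFinM mule_ge0 ?lee_fin//.
  by have := nnfun_muleindic_ge0 (h n) y (Y w); rewrite lee_fin.
Qed.

(** Independence is a statement on indicators; they are replaced by the functions f i
    one index at a time, the set J being that of the indices already treated. *)
Lemma independent_prod_expectation (I : finType) (Y : I -> {RV P >-> T'})
    (f : I -> T' -> R) (B : I -> R) :
  mutually_independent Y ->
  (forall i A, measurable A -> distribution P (Y i) A = Q A) ->
  (forall i, measurable_fun setT (f i)) -> (forall i x, (0 <= f i x)%R) ->
  (forall i, \int[Q]_x (f i x)%:E = (B i)%:E) ->
  \int[P]_w (\prod_i f i (Y i w))%:E = (\prod_i B i)%:E.
Proof.
move=> ind dist mf f0 fB.
have B0 i : (0 <= B i)%R.
  by rewrite -lee_fin -fB; apply: integral_ge0 => x _; rewrite lee_fin.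
pose F (J : {set I}) (A : I -> set T') i : T' -> R :=
  if i \in J then f i else \1_(A i).
pose C (J : {set I}) (A : I -> set T') i : R := if i \in J then B i else fine (Q (A i)).
suff claim (J : {set I}) (A : I -> set T') : (forall i, measurable (A i)) ->
    \int[P]_w (\prod_i F J A i (Y i w))%:E = (\prod_i C J A i)%:E.
  have := claim [set: I]%SET (fun=> setT) (fun=> measurableT).
  under eq_integral => w _ do under eq_bigr do rewrite /F finset.in_setT.
  by under [in RHS]eq_bigr do rewrite /C finset.in_setT.
have QE D : measurable D -> (fine (Q D))%:E = Q D.
  by move=> mD; rewrite fineK// fin_num_measure.
have F0 K D i x : (0 <= F K D i x)%R by rewrite /F; case: ifP.
have mF K D i : measurable (D i) -> measurable_fun setT (F K D i).
  by move=> mD; rewrite /F; case: ifP.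
have C0 K D i : (0 <= C K D i)%R by rewrite /C; case: ifP => // _; apply: fine_ge0.
move: {2}#|J| (erefl #|J|) => m; elim: m J A => [|m IH] J A.
  move=> /eqP; rewrite cards_eq0 => /eqP -> mA.
  have -> : \int[P]_w (\prod_i F finset.set0 A i (Y i w))%:E =
      P (\bigcap_(i in [set` [set: I]%SET]) (Y i @^-1` A i)).
    have mI : measurable (\bigcap_(i in [set` [set: I]%SET]) (Y i @^-1` A i)).
      apply: fin_bigcap_measurable => [|i _]; first exact: finite_finset.
      by apply: measurable_funPTI.
    rewrite -[X in P X]setIT -integral_indic//.
    apply: eq_integral => w _; congr EFin; rewrite indicE.
    under eq_bigr do rewrite /F finset.in_set0 indicE.
    case: (boolP (w \in _)) => [/set_mem hw|hw].
      rewrite big1// => i _; rewrite mem_set//.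
      by apply: hw => /=; rewrite finset.in_setT.
    apply/eqP/prodf_eq0.
    have : ~ (forall i, A i (Y i w)).
      by move=> h; move/negP: hw; apply; apply: mem_set => i _; exact: h.
    move=> /existsNP[i hi]; exists i => //.
    by rewrite memNset.
  rewrite (ind [set: I]%SET A); last by move=> i _.
  rewrite (big_morph EFin EFinM (erefl _)).
  apply: eq_big => [i|i _]; first by rewrite finset.in_setT.
  by rewrite /C finset.in_set0 QE// -(dist i).
move=> cJ mA.
have /card_gt0P[k kJ] : (0 < #|J|)%N by rewrite cJ.
have cJ' : #|(J :\ k)%SET| = m by move: cJ; rewrite (cardsD1 k J) kJ add1n => -[].
rewrite (bigD1 k)//= [in RHS]mulrC EFinM [C J A k]/C kJ -(fB k).
under eq_integral do rewrite (bigD1 k)//= {1}/F kJ mulrC.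
pose g w := (\prod_(i | i != k) F J A i (Y i w))%R.
apply: (@integral_factor g (Y k) _ (f k)) => //.
- apply: (measurable_fun_big _ _ _).1 => i; apply: measurableT_comp => //; exact: mF.
- by move=> w; apply: prodr_ge0 => i _.
- exact: prodr_ge0.
move=> D mD.
pose A' i := if i == k then D else A i.
have mA' i : measurable (A' i) by rewrite /A'; case: ifP.
have := IH _ A' cJ' mA'.
have Ck : C (J :\ k)%SET A' k = fine (Q D) by rewrite /C finset.in_setD1 eqxx /A' eqxx.
have Fk : F (J :\ k)%SET A' k = \1_D by rewrite /F finset.in_setD1 eqxx /A' eqxx.
rewrite (bigD1 k)//= Ck EFinM QE// muleC.
under eq_integral do rewrite (bigD1 k)//= Fk mulrC.
have eF w : (\prod_(i | i != k) F (J :\ k)%SET A' i (Y i w))%R = g w.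
  by apply: eq_bigr => i ik; rewrite /F finset.in_setD1 ik /A' (negbTE ik).
under eq_integral do rewrite eF.
have -> // : (\prod_(i | i != k) C (J :\ k)%SET A' i)%R = (\prod_(i | i != k) C J A i)%R.
by apply: eq_bigr => i ik; rewrite /C finset.in_setD1 ik /A' (negbTE ik).
Qed.
End Independence.

(** * The PAC-Bayes event *)

Section PacBayes.
Context (R : realType) (d : measure_display) (T : measurableType d)
  (P : probability T R).
Local Open Scope ereal_scope.

Lemma prior_op_integral (M r : nat) (F : seq int -> T -> R) :
  (forall ks, measurable_fun setT (F ks)) -> (forall ks w, (0 <= F ks w)%R) ->
  (forall ks, \int[P]_w (F ks w)%:E <= 1) ->
  [/\ measurable_fun setT (fun w => prior_op M r (F^~ w)),
      forall w, (0 <= prior_op M r (F^~ w))%R &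
      \int[P]_w (prior_op M r (F^~ w))%:E <= 1].
Proof.
elim: r F => [|r IH] F mF F0 F1 /=; first by split.
pose H k w := prior_op M r (fun ks => F (k :: ks) w).
have HP k := IH (fun ks => F (k :: ks)) (fun ks => mF _) (fun ks => F0 _)
  (fun ks => F1 _).
have mH k : measurable_fun setT (fun w => prior_weight R k * H k w)%R.
  by apply: measurable_funM => //; have [] := HP k.
have H0 k w : (0 <= prior_weight R k * H k w)%R.
  apply: mulr_ge0; first exact: ltW (prior_weight_gt0 _ _).
  by have [_ + _] := HP k; apply.
split; rewrite /prior1.
- exact: (measurable_fun_big _ _ mH).2.
- by move=> w; apply: sumr_ge0 => k _; exact: H0.
under eq_integral do rewrite -sumEFin.
rewrite ge0_integral_sum//; first last.
- by move=> k w _; rewrite lee_fin; exact: H0.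
- by move=> k; apply/measurable_EFinP; exact: mH.
apply: (@le_trans _ _ (\sum_(k <- int_window M) (prior_weight R k)%:E)); last first.
  by rewrite sumEFin lee_fin prior_mass_le1.
apply: lee_sum => k _; under eq_integral do rewrite EFinM.
have [mHk Hk0 Hk1] := HP k.
rewrite ge0_integralZl_EFin//.
- rewrite -[leRHS]mule1; apply: lee_wpmul2l => //.
  by rewrite lee_fin; exact: ltW (prior_weight_gt0 _ _).
- by move=> w _; rewrite lee_fin.
- exact/measurable_EFinP.
- exact: ltW (prior_weight_gt0 _ _).
Qed.

Lemma markov_event (Z : T -> R) (eps : R) : (0 < eps)%R ->
  measurable_fun setT Z -> (forall w, (0 <= Z w)%R) -> \int[P]_w (Z w)%:E <= 1 ->
  exists A : set T, [/\ measurable A, (1 - eps)%:E <= P A &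
    forall w, A w -> (Z w <= eps^-1)%R].
Proof.
move=> eps0 mZ Z0 Z1.
pose B := [set w | (eps^-1 < Z w)%R].
have mB : measurable B.
  have mb : measurable_fun setT (fun w => (cst eps^-1%R w < Z w)%R).
    by apply: measurable_fun_ltr.
  have := mb measurableT [set true] I; rewrite setTI.
  by congr measurable.
exists (~` B); split; first exact: measurableC.
- rewrite probability_setC//.
  have : eps^-1%:E * P B <= 1.
    apply: le_trans Z1; rewrite -integral_cst//.
    apply: (@le_trans _ _ (\int[P]_(w in B) (Z w)%:E)).
      apply: ge0_le_integral => //=.
      all: try (by move=> w _; rewrite lee_fin ?invr_ge0 ?ltW).
      all: try (by move=> w Bw; rewrite lee_fin ltW).
      by apply/measurable_EFinP; exact: measurable_funTS.
    apply: ge0_subset_integral => //; first exact/measurable_EFinP.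
    by move=> w _; rewrite lee_fin.
  rewrite -(@fineK _ (P B)) ?fin_num_measure//.
  by rewrite -EFinM -EFinB !lee_fin mulrC ler_pdivrMr// mul1r lerD2l lerN2.
- by move=> w; rewrite /B /= => /negP; rewrite -leNgt.
Qed.

Context (d' : measure_display) (T' : measurableType d') (Q : probability T' R).

(** For each grid point the normalized product has mean 1, so that its prior average
    has mean at most 1 and Markov's inequality applies.  The event does not involve
    any direction, hence the uniformity in the perturbed law later on. *)
Lemma pac_bayes_event (n M r : nat) (Y : 'I_n -> {RV P >-> T'})
    (f : seq int -> T' -> R) (B : seq int -> R) (eps : R) :
  mutually_independent Y ->
  (forall i A, measurable A -> distribution P (Y i) A = Q A) ->
  (0 < eps)%R ->
  (forall ks, measurable_fun setT (f ks)) -> (forall ks x, (0 < f ks x)%R) ->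
  (forall ks, (0 < B ks)%R) ->
  (forall ks, \int[Q]_x (f ks x)%:E = (B ks)%:E) ->
  exists A : set T, [/\ measurable A, (1 - eps)%:E <= P A &
    forall w, A w -> (prior_op M r (fun ks => \prod_i (f ks (Y i w) / B ks)) <= eps^-1)%R].
Proof.
move=> ind dist eps0 mf f0 B0 fB.
pose F ks w : R := (\prod_i (f ks (Y i w) / B ks))%R.
have mg ks : measurable_fun setT (fun x => f ks x / B ks)%R.
  exact: measurable_funM.
have g0 ks x : (0 <= f ks x / B ks)%R by rewrite divr_ge0 ?ltW.
have [] := @prior_op_integral M r F.
- move=> ks; apply: (measurable_fun_big _ _ _).1 => i.
  by apply: (measurableT_comp (mg ks)).
- by move=> ks w; apply: prodr_ge0.
- move=> ks.
  rewrite (@independent_prod_expectation _ _ _ _ _ P Q 'I_n Y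
    (fun _ x => f ks x / B ks)%R (fun=> 1%R))//; last first.
    move=> _; under eq_integral do rewrite mulrC EFinM.
    rewrite ge0_integralZl_EFin//.
    + by rewrite fB -EFinM mulVf// gt_eqF.
    + by move=> x _; rewrite lee_fin ltW.
    + exact/measurable_EFinP.
    + by rewrite invr_ge0 ltW.
  - by rewrite big1.
move=> mZ Z0 Z1; have [A [mA PA hA]] := markov_event eps0 mZ Z0 Z1.
by exists A.
Qed.

End PacBayes.

(** * Square integrable functions and orthonormal families *)

Section SquareIntegrable.
Context (R : realType) (d : measure_display) (T : measurableType d)
  (Q : probability T R).
Implicit Types (f g : T -> R) (a : R).

Definition intg f := Q.-integrable setT (EFin \o f).
Definition Ex f : R := \int[Q]_x f x.

Lemma intg_meas f : intg f -> measurable_fun setT f.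
Proof. by move=> /measurable_int /measurable_EFinP. Qed.

Lemma ExE f : intg f -> (\int[Q]_x (f x)%:E)%E = (Ex f)%:E.
Proof. by move=> hf; rewrite /Ex /Rintegral fineK// integrable_fin_num. Qed.

Lemma intg_cst a : intg (fun=> a).
Proof. exact: finite_measure_integrable_cst. Qed.

Lemma intgD f g : intg f -> intg g -> intg (fun x => f x + g x).
Proof.
by move=> hf hg; have := integrableD measurableT hf hg; apply: eq_integrable.
Qed.

Lemma intgZ a f : intg f -> intg (fun x => a * f x).
Proof.
by move=> hf; have := integrableZl measurableT a hf; apply: eq_integrable.
Qed.

Lemma ExD f g : intg f -> intg g -> Ex (fun x => f x + g x) = Ex f + Ex g.
Proof. by move=> hf hg; exact: RintegralD. Qed.

Lemma ExZ a f : intg f -> Ex (fun x => a * f x) = a * Ex f.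
Proof. by move=> hf; exact: RintegralZl. Qed.

Lemma Ex_cst a : Ex (fun=> a) = a.
Proof.
have e : fine (Q setT) = 1 by rewrite probability_setT.
by rewrite /Ex Rintegral_cst// -[RHS]mulr1; congr (_ * _); exact: e.
Qed.

Lemma Ex_le f g : intg f -> intg g -> (forall x, f x <= g x) -> Ex f <= Ex g.
Proof. by move=> hf hg fg; apply: le_Rintegral. Qed.

Lemma Ex_ge0 f : (forall x, 0 <= f x) -> 0 <= Ex f.
Proof. by move=> f0; apply: Rintegral_ge0. Qed.

Lemma intg_sum (I : Type) (s : seq I) (F : I -> T -> R) :
  (forall i, intg (F i)) ->
  intg (fun x => \sum_(i <- s) F i x) /\
  Ex (fun x => \sum_(i <- s) F i x) = \sum_(i <- s) Ex (F i).
Proof.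
move=> hF; elim: s => [|i s [IH1 IH2]].
  under eq_fun do rewrite big_nil.
  by rewrite big_nil Ex_cst; split=> //; exact: intg_cst.
under eq_fun do rewrite big_cons.
by rewrite big_cons ExD// IH2; split=> //; exact: intgD.
Qed.

Lemma le_intg f g : measurable_fun setT f -> intg g ->
  (forall x, `|f x| <= g x) -> intg f.
Proof.
move=> mf hg fg; apply: (le_integrable measurableT _ _ hg).
  exact/measurable_EFinP.
by move=> x _; rewrite /= lee_fin (le_trans (fg x))// ler_norm.
Qed.

Definition sqint f := measurable_fun setT f /\ intg (fun x => f x ^+ 2).

Lemma sqint_mul f g : sqint f -> sqint g -> intg (fun x => f x * g x).
Proof.
move=> [mf hf] [mg hg]; apply: (@le_intg _ (fun x => f x ^+ 2 + g x ^+ 2)).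
- exact: measurable_funM.
- exact: intgD.
move=> x; rewrite ler_norml.
have := sqr_ge0 (f x + g x); have := sqr_ge0 (f x - g x).
by have := sqr_ge0 (f x); have := sqr_ge0 (g x); nra.
Qed.

Lemma sqintZ a f : sqint f -> sqint (fun x => a * f x).
Proof.
move=> [mf hf]; split; first exact: measurable_funM.
by under eq_fun do rewrite exprMn; exact: intgZ.
Qed.

Lemma sqintD f g : sqint f -> sqint g -> sqint (fun x => f x + g x).
Proof.
move=> sf sg; split; first by apply: measurable_funD; [case: sf|case: sg].
have -> : (fun x => (f x + g x) ^+ 2) =
    (fun x => f x ^+ 2 + (g x ^+ 2 + 2 * (f x * g x))).
  by apply/funext => x; ring.
apply: intgD; first by case: sf.
by apply: intgD; [case: sg|apply: intgZ; exact: sqint_mul].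
Qed.

Lemma sqint_cst a : sqint (fun=> a).
Proof. by split; [exact: measurable_cst|exact: intg_cst]. Qed.

Lemma sqint_sum (I : Type) (s : seq I) (F : I -> T -> R) :
  (forall i, sqint (F i)) -> sqint (fun x => \sum_(i <- s) F i x).
Proof.
move=> hF; elim: s => [|i s IH].
  by under eq_fun do rewrite big_nil; exact: sqint_cst.
by under eq_fun do rewrite big_cons; exact: sqintD.
Qed.

Lemma sqint_intg f : sqint f -> intg f.
Proof.
move=> sf; have := sqint_mul sf (sqint_cst 1).
by under eq_fun do rewrite mulr1.
Qed.

(** Used to discard, outside one null event, all the directions with N = 0. *)
Lemma Ex_sqr_eq0 f : sqint f -> Ex (fun x => f x ^+ 2) = 0 ->
  Q [set x | f x != 0] = 0%E.
Proof.
move=> [mf hf] h0.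
have mB : measurable [set x | f x != 0].
  have := mf measurableT (~` [set 0]) (measurableC (measurable_set1 _)).
  rewrite setTI; congr measurable; apply/seteqP; split=> x /= /eqP; exact.
have e : (\int[Q]_x `|(f x ^+ 2)%:E|)%E = 0%E.
  under eq_integral do rewrite gee0_abs ?lee_fin ?sqr_ge0//.
  by rewrite ExE// h0.
have mE : measurable_fun setT (fun x => (f x ^+ 2)%:E).
  by apply/measurable_EFinP; exact: measurable_funX.
have := (ae_eq_integral_abs Q measurableT mE).1 e.
move=> [N [mN N0 sub]]; apply/eqP; rewrite -measure_le0 -N0.
apply: le_measure; rewrite ?inE//.
apply: subset_trans sub => x /= fx0 /(_ I) [] /eqP.
by rewrite sqrf_eq0 (negbTE fx0).
Qed.

End SquareIntegrable.

Section GramSchmidt.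
Context (R : realType) (d : measure_display) (T : measurableType d)
  (Q : probability T R) (V : (T -> R) -> Prop).
Hypothesis V_lin : forall a f g, V f -> V g -> V (fun x => a * f x + g x).
Hypothesis V0 : V (fun=> 0).
Hypothesis V_sq : forall f, V f -> sqint Q f.

Definition comb r (c : 'I_r -> R) (o : 'I_r -> T -> R) (x : T) : R :=
  \sum_i c i * o i x.

Lemma V_comb r (c : 'I_r -> R) (o : 'I_r -> T -> R) :
  (forall i, V (o i)) -> V (comb c o).
Proof.
move=> Vo; rewrite /comb; elim: (index_enum _) => [|i s IH].
  by under eq_fun do rewrite big_nil.
by under eq_fun do rewrite big_cons; exact: V_lin.
Qed.

(** Orthonormality is expressed by the values of the bilinear form on linear
    combinations, which is the form needed both for the induction of
    [gram_schmidt] and for computing E <t, X>^2. *)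
Definition orthonormal_family r (o : 'I_r -> T -> R) :=
  (forall i, V (o i)) /\
  forall c c', Ex Q (fun x => comb c o x * comb c' o x) = \sum_i c i * c' i.

(** Vectors of zero norm need not vanish: the remainder k of the projection is either
    normalized into a new element of the family or kept as a null remainder. *)
Lemma gram_schmidt m (g : 'I_m -> T -> R) : (forall i, V (g i)) ->
  exists (r : nat) (o : 'I_r -> T -> R), [/\ (r <= m)%N, orthonormal_family o &
    forall i, exists (c : 'I_r -> R) (k : T -> R),
      [/\ V k, Ex Q (fun x => k x ^+ 2) = 0 & forall x, g i x = comb c o x + k x]].
Proof.
elim: m g => [|m IH] g Vg.
  exists 0%N, g; split=> //; last by case.
  split=> [i|c c']; first by case: i.
  rewrite big_ord0 -[RHS](Ex_cst Q 0); congr Ex.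
  by apply/funext => x; rewrite /comb big_ord0 mul0r.
have [r [u [rm [Vo Oo] dec]]] := IH _ (fun i => Vg (lift ord0 i)); rename u into o.
pose g0 := g ord0.
have sg0 : sqint Q g0 := V_sq (Vg ord0).
have so i : sqint Q (o i) := V_sq (Vo i).
have sc c : sqint Q (comb c o) := V_sq (V_comb c Vo).
pose p i := Ex Q (fun x => g0 x * o i x).
pose y x := -1 * comb p o x + g0 x.
have Vy : V y by apply: V_lin; [exact: V_comb|exact: Vg].
have yorth c : Ex Q (fun x => y x * comb c o x) = 0.
  have -> : (fun x => y x * comb c o x) = (fun x => -1 * (comb p o x * comb c o x) +
      \sum_i c i * (g0 x * o i x)).
    apply/funext => x; rewrite /y mulrDl mulrA; congr (_ + _).
    by rewrite /comb mulr_sumr; apply: eq_bigr => i _; ring.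
  have ic i : intg Q (fun x => c i * (g0 x * o i x)).
    by apply: intgZ; exact: sqint_mul.
  rewrite ExD.
  - rewrite ExZ ?Oo; last exact: sqint_mul.
    rewrite (intg_sum _ ic).2 mulN1r; apply/eqP; rewrite addrC subr_eq0; apply/eqP.
    apply: eq_bigr => i _; rewrite (ExZ (c i)); last exact: sqint_mul.
    by rewrite mulrC.
  - by apply: intgZ; exact: sqint_mul.
  - exact: (intg_sum _ ic).1.
have [y0|y0] := eqVneq (Ex Q (fun x => y x ^+ 2)) 0.
  exists r, o; split=> //; first exact: leqW.
  move=> i; have [j ->|->] := unliftP ord0 i; first exact: dec.
  by exists p, y; split=> // x; rewrite /y mulN1r addrA subrr add0r.
set N := Ex Q _ in y0.
have N0 : 0 < N.
  by rewrite lt_neqAle eq_sym y0; apply: Ex_ge0 => x; exact: sqr_ge0.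
pose s := Num.sqrt N.
have s0 : 0 < s by rewrite sqrtr_gt0.
pose o' (i : 'I_r.+1) : T -> R :=
  if unlift ord0 i is Some j then o j else fun x => s^-1 * y x + 0.
have o'0 : o' ord0 = fun x => s^-1 * y x + 0 by rewrite /o' unlift_none.
have o'S j : o' (lift ord0 j) = o j by rewrite /o' liftK.
have combE c x : comb c o' x = c ord0 * (s^-1 * y x) + comb (fun j => c (lift ord0 j)) o x.
  rewrite /comb big_ord_recl o'0 addr0; congr (_ + _).
  by apply: eq_bigr => i _; rewrite o'S.
exists r.+1, o'; split=> //.
- split=> [i|c c'].
    have [j ->|->] := unliftP ord0 i; first by rewrite o'S.
    by rewrite o'0; exact: V_lin.
  pose b (c : 'I_r.+1 -> R) j := c (lift ord0 j).
  have -> : (fun x => comb c o' x * comb c' o' x) = (fun x =>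
      c ord0 * c' ord0 / N * y x ^+ 2 + (c ord0 / s * (y x * comb (b c') o x) +
      (c' ord0 / s * (y x * comb (b c) o x) + comb (b c) o x * comb (b c') o x))).
    apply/funext => x; rewrite !combE -/(b c) -/(b c').
    have -> : N = s ^+ 2 by rewrite sqr_sqrtr// ltW.
    by field; rewrite gt_eqF.
  have sy := V_sq Vy; have sb c0 := V_sq (V_comb (b c0) Vo).
  have i1 : intg Q (fun x => y x ^+ 2) by case: sy.
  have i2 c0 : intg Q (fun x => y x * comb (b c0) o x) by exact: sqint_mul.
  have i3 := sqint_mul (sb c) (sb c').
  rewrite ExD; [|exact: intgZ|by apply: intgD; [exact: intgZ|apply: intgD => //; exact: intgZ]].
  rewrite ExD; [|exact: intgZ|by apply: intgD => //; exact: intgZ].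
  rewrite ExD; [|exact: intgZ|by []].
  rewrite !ExZ// !yorth Oo big_ord_recl -/N !mulr0 !add0r.
  by rewrite divfK.
- move=> i; have [j ->|->] := unliftP ord0 i.
    have [c [k [Vk k0 e]]] := dec j.
    exists (fun i => if unlift ord0 i is Some j then c j else 0), k; split=> // x.
    rewrite combE unlift_none mul0r add0r e; congr (_ + _).
    by apply: eq_bigr => l _; rewrite liftK.
  exists (fun i => if unlift ord0 i is Some j then p j else s), (fun=> 0); split=> //.
    rewrite -[RHS](Ex_cst Q 0); congr Ex; apply/funext => x; exact: expr0n.
  move=> x; rewrite combE unlift_none addr0 mulrA divff ?gt_eqF// mul1r /y.
  have -> : comb (fun j => match unlift ord0 (lift ord0 j) with
     | Some j0 => p j0 | None => s end) o x = comb p o x.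
    by apply: eq_bigr => l _; rewrite liftK.
  by rewrite mulN1r addrAC addNr add0r.
Qed.

End GramSchmidt.

(** * Moments of the perturbed criterion *)

Section SmoothedMoments.
Context (R : realType) (d : measure_display) (T : measurableType d)
  (Q : probability T R) (V : (T -> R) -> Prop) (kappa : R).
Hypothesis V_lin : forall a f g, V f -> V g -> V (fun x => a * f x + g x).
Hypothesis V0 : V (fun=> 0).
Hypothesis V_sq : forall f, V f -> sqint Q f.
Hypothesis V_4 : forall f, V f -> sqint Q (fun x => f x ^+ 2).
Hypothesis V_kurt : forall f, V f -> Ex Q (fun x => f x ^+ 2) = 1 ->
  Ex Q (fun x => f x ^+ 2 * f x ^+ 2) <= kappa.

(** After normalization, from 2 f^2 g^2 <= f^4 + g^4. *)
Lemma mixed_fourth_moment f g : V f -> V g ->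
  0 < Ex Q (fun x => f x ^+ 2) -> 0 < Ex Q (fun x => g x ^+ 2) ->
  Ex Q (fun x => f x ^+ 2 * g x ^+ 2) <=
    kappa * (Ex Q (fun x => f x ^+ 2) * Ex Q (fun x => g x ^+ 2)).
Proof.
move=> Vf Vg.
have unit k : V k -> 0 < Ex Q (fun x => k x ^+ 2) -> exists2 k' : T -> R,
    V k' /\ Ex Q (fun x => k' x ^+ 2) = 1 &
    forall x, k x ^+ 2 = Ex Q (fun x => k x ^+ 2) * k' x ^+ 2.
  move=> Vk; set N := Ex Q _ => N0.
  have s0 : 0 < Num.sqrt N by rewrite sqrtr_gt0.
  exists (fun x => (Num.sqrt N)^-1 * k x + 0); last first.
    move=> x; rewrite addr0 exprMn exprVn sqr_sqrtr ?(ltW N0)// mulrA divff ?mul1r//.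
    by rewrite gt_eqF.
  split; first exact: V_lin.
  have -> : (fun x => ((Num.sqrt N)^-1 * k x + 0) ^+ 2) = (fun x => N^-1 * k x ^+ 2).
    by apply/funext => x; rewrite addr0 exprMn exprVn sqr_sqrtr ?(ltW N0).
  rewrite ExZ; last by case: (V_sq Vk).
  by rewrite -/N mulVf// gt_eqF.
move=> f0 g0.
have [f1 [Vf1 f11] fE] := unit _ Vf f0; have [g1 [Vg1 g11] gE] := unit _ Vg g0.
set Nf := Ex Q (fun x => f x ^+ 2) in f0 fE *.
set Ng := Ex Q (fun x => g x ^+ 2) in g0 gE *.
have -> : (fun x => f x ^+ 2 * g x ^+ 2) =
    (fun x => Nf * Ng * (f1 x ^+ 2 * g1 x ^+ 2)).
  by apply/funext => x; rewrite fE gE; ring.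
have i1 : intg Q (fun x => f1 x ^+ 2 * f1 x ^+ 2) by apply: sqint_mul; exact: V_4.
have i2 : intg Q (fun x => g1 x ^+ 2 * g1 x ^+ 2) by apply: sqint_mul; exact: V_4.
have i3 : intg Q (fun x => f1 x ^+ 2 * g1 x ^+ 2) by apply: sqint_mul; exact: V_4.
rewrite ExZ// mulrC; apply: ler_wpM2r; first by rewrite mulr_ge0// ltW.
apply: (@le_trans _ _ (Ex Q (fun x =>
    1 / 2 * (f1 x ^+ 2 * f1 x ^+ 2) + 1 / 2 * (g1 x ^+ 2 * g1 x ^+ 2)))).
  apply: Ex_le; [exact: i3|by apply: intgD; exact: intgZ|move=> x].
  have := sqr_ge0 (f1 x ^+ 2 - g1 x ^+ 2); nra.
rewrite ExD; [|exact: intgZ..].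
rewrite !ExZ//; have := V_kurt Vf1 f11; have := V_kurt Vg1 g11; lra.
Qed.

Variables (r : nat) (o : 'I_r -> T -> R).
Hypothesis oO : orthonormal_family Q V o.

Let Vo i : V (o i). Proof. by have [] := oO. Qed.

Lemma Ex_comb_sqr c : Ex Q (fun x => comb c o x ^+ 2) = \sum_i c i ^+ 2.
Proof. by have [_ /(_ c c)] := oO. Qed.

Lemma Ex_orthonormal_sqr i : Ex Q (fun x => o i x ^+ 2) = 1.
Proof.
have -> : (fun x => o i x ^+ 2) = (fun x => comb (fun j => (j == i)%:R) o x ^+ 2).
  apply/funext => x; congr (_ ^+ 2); rewrite /comb (bigD1 i)//= eqxx mul1r.
  by rewrite big1 ?addr0// => j /negbTE ->; rewrite mul0r.
rewrite Ex_comb_sqr (bigD1 i)//= eqxx expr1n big1 ?addr0// => j /negbTE ->.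
by rewrite expr0n.
Qed.

Definition coords (x : T) : seq R := [seq o i x | i <- enum 'I_r].
Definition sqnorm (x : T) : R := dots (coords x) (coords x).

Lemma dots_map (I : Type) (s : seq I) (f g : I -> R) :
  dots (map f s) (map g s) = \sum_(i <- s) f i * g i.
Proof. by elim: s => [|i s IH]/=; rewrite ?big_nil// big_cons IH. Qed.

Lemma sqnormE : sqnorm = fun x => \sum_i o i x ^+ 2.
Proof. by apply/funext => x; rewrite /sqnorm dots_map big_enum. Qed.

Lemma sqint_sqnorm : sqint Q sqnorm.
Proof. by rewrite sqnormE; apply: sqint_sum => i; exact: V_4. Qed.

Lemma Ex_sqr_sqnorm f : V f -> 0 < Ex Q (fun x => f x ^+ 2) ->
  Ex Q (fun x => f x ^+ 2 * sqnorm x) <=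
    kappa * r%:R * Ex Q (fun x => f x ^+ 2).
Proof.
move=> Vf f0; rewrite sqnormE.
have -> : (fun x => f x ^+ 2 * (\sum_i o i x ^+ 2)) =
    (fun x => \sum_i f x ^+ 2 * o i x ^+ 2).
  by apply/funext => x; rewrite mulr_sumr.
have ii i : intg Q (fun x => f x ^+ 2 * o i x ^+ 2) by apply: sqint_mul; exact: V_4.
rewrite (intg_sum _ ii).2.
apply: (@le_trans _ _ (\sum_(i < r) kappa * Ex Q (fun x => f x ^+ 2))).
  apply: ler_sum => i _; have := mixed_fourth_moment Vf (Vo i) f0.
  by rewrite Ex_orthonormal_sqr mulr1; apply.
by rewrite sumr_const card_ord -[leLHS]mulr_natr mulrAC.
Qed.

Lemma Ex_sqnorm2 : Ex Q (fun x => sqnorm x * sqnorm x) <= kappa * r%:R * r%:R.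
Proof.
have -> : (fun x => sqnorm x * sqnorm x) = (fun x => \sum_i o i x ^+ 2 * sqnorm x).
  by apply/funext => x; rewrite {1}sqnormE mulr_suml.
have ii i : intg Q (fun x => o i x ^+ 2 * sqnorm x).
  by apply: sqint_mul; [exact: V_4|exact: sqint_sqnorm].
rewrite (intg_sum _ ii).2.
apply: (@le_trans _ _ (\sum_(i < r) kappa * r%:R)).
  apply: ler_sum => i _; have := @Ex_sqr_sqnorm (o i) (Vo i).
  by rewrite Ex_orthonormal_sqr mulr1; apply.
by rewrite sumr_const card_ord -[leLHS]mulr_natr.
Qed.

Variables (v lam sg : R).
Hypotheses (v0 : 0 < v) (lamb : 0 <= lam <= 2) (sg2 : sg ^+ 2 = 1).

Let h : R := 2 * Num.sqrt v.

Let h0 : 0 < h. Proof. by rewrite mulr_gt0// sqrtr_gt0. Qed.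

Let h2 : h ^+ 2 = 4 * v.
Proof. by rewrite exprMn sqr_sqrtr ?(ltW v0)//; ring. Qed.

(** The linear form whose coefficients are the point h * ks of the grid; the step
    h = 2 sqrt v turns the variance 1/4 of the spline law into v. *)
Definition grid_form (ks : seq int) (x : T) : R := h * dots (coords x) (map intr ks).

Lemma V_grid_form ks : V (grid_form ks).
Proof.
rewrite /grid_form /coords; elim: (enum _) ks => [|i s IH] [|k ks] /=.
- by under eq_fun do rewrite mulr0.
- by under eq_fun do rewrite mulr0.
- by under eq_fun do rewrite mulr0.
have -> : (fun x => h * (o i x * k%:~R + dots [seq o i0 x | i0 <- s] (map intr ks))) =
  (fun x => (h * k%:~R) * o i x + h * dots [seq o i0 x | i0 <- s] (map intr ks)).
  by apply/funext => x; ring.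
exact: V_lin.
Qed.

Definition smoothed (ks : seq int) (x : T) : R :=
  perturbed_factor sg lam (v * sqnorm x) (grid_form ks x).

Let sqnorm_ge0 x : 0 <= sqnorm x.
Proof. by rewrite sqnormE; apply: sumr_ge0 => i _; exact: sqr_ge0. Qed.

Lemma smoothed_ge ks x : 1 / 2 <= smoothed ks x.
Proof.
have /andP[lam0 _] := lamb.
rewrite /smoothed /perturbed_factor /slack.
set u := lam * _.
have -> : u ^+ 2 = (sg * u) ^+ 2 by rewrite [in RHS]exprMn sg2 mul1r.
have := quad_gt0 (sg * u).
have : 0 <= 60 * (lam * (v * sqnorm x)) * (lam * grid_form ks x ^+ 2).
  have P0 : 0 <= v * sqnorm x by rewrite mulr_ge0// ltW.
  apply: mulr_ge0; last by apply: mulr_ge0; [exact: lam0|exact: sqr_ge0].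
  by apply: mulr_ge0; [exact: ler0n|exact: mulr_ge0].
have : 0 <= 600 * (lam * (v * sqnorm x)) ^+ 2.
  by apply: mulr_ge0; [exact: ler0n|exact: sqr_ge0].
lra.
Qed.

Lemma intg_smoothed ks : intg Q (smoothed ks).
Proof.
have sA := V_4 (V_grid_form ks); have sP := sqintZ v sqint_sqnorm.
pose u x := lam * (grid_form ks x ^+ 2 + (-1 * (v * sqnorm x) + -1)).
have su : sqint Q u.
  apply: sqintZ; apply: sqintD => //; apply: sqintD; last exact: sqint_cst.
  exact: sqintZ.
have -> : smoothed ks = fun x => 1 + (sg * u x + (1 / 2 * (u x * u x) +
    (60 * lam ^+ 2 * (v * sqnorm x * grid_form ks x ^+ 2) +
     600 * lam ^+ 2 * (v * sqnorm x * (v * sqnorm x))))).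
  by apply/funext => x; rewrite /smoothed /perturbed_factor /slack /u; field.
apply: intgD; first exact: intg_cst.
apply: intgD; first by apply: intgZ; exact: sqint_intg.
apply: intgD; first by apply: intgZ; exact: sqint_mul.
by apply: intgD; apply: intgZ; exact: sqint_mul.
Qed.

Lemma spline_op_Ex z (F : int -> T -> R) : (forall k, intg Q (F k)) ->
  intg Q (fun x => spline_op z (F^~ x)) /\
  Ex Q (fun x => spline_op z (F^~ x)) = spline_op z (fun k => Ex Q (F k)).
Proof.
move=> iF; rewrite /spline_op.
have i1 a k : intg Q (fun x => a * F k x) by exact: intgZ.
split; first by apply: intgD => //; exact: intgD.
by rewrite ExD//; [rewrite ExD// !ExZ|exact: intgD].
Qed.

(** Averages over the grid are finite sums, so they commute with expectations. *)
Lemma grid_op_Ex zs (F : seq int -> T -> R) : (forall ks, intg Q (F ks)) ->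
  intg Q (fun x => grid_op zs (F^~ x)) /\
  Ex Q (fun x => grid_op zs (F^~ x)) = grid_op zs (fun ks => Ex Q (F ks)).
Proof.
elim: zs F => [|z zs IH] F iF /=; first by split.
pose G k x := grid_op zs (fun ks => F (k :: ks) x).
have GP k := IH (fun ks => F (k :: ks)) (fun ks => iF _).
have [i e] := @spline_op_Ex z G (fun k => (GP k).1).
split; first exact: i.
rewrite -/(G) e; congr spline_op; apply/funext => k; exact: (GP k).2.
Qed.

Variable c : 'I_r -> R.
Let zs : seq R := [seq c i / h | i <- enum 'I_r].

Lemma centers_sqr : dots zs zs = (\sum_i c i ^+ 2) / (4 * v).
Proof.
rewrite dots_map big_enum mulr_suml; apply: eq_bigr => i _.
by rewrite -h2; field; rewrite gt_eqF.
Qed.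

Lemma grid_form_split ks x :
  grid_form ks x = comb c o x + h * grid_dev zs (coords x) ks.
Proof.
rewrite /grid_form /grid_dev mulrBr /comb.
rewrite /zs /coords dots_map big_enum/= [X in _ = _ + (_ - X)]mulr_sumr.
under [X in _ = _ + (_ - X)]eq_bigr => i _.
  have -> : h * (o i x * (c i / h)) = c i * o i x by field; rewrite gt_eqF.
  over.
by rewrite addrC subrK.
Qed.

Lemma perturbation_moments x :
  let b ks := h * grid_dev zs (coords x) ks in
  [/\ grid_op zs b = 0, grid_op zs (fun ks => b ks ^+ 2) = v * sqnorm x &
    grid_op zs (fun ks => b ks ^+ 4) <= 4 * (v * sqnorm x) ^+ 2].
Proof.
have P := grid_opP zs.
have [|] := @grid_moments R zs (coords x); first by rewrite /zs /coords !size_map.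
set q := _ / 4 => m1 m2 m4 /=.
have qE : v * sqnorm x = h ^+ 2 * q by rewrite h2 /q -/(sqnorm x); field.
split.
- by rewrite (opZ P) m1 mulr0.
- by under eq_fun do rewrite exprMn; rewrite (opZ P) m2 qE.
- under eq_fun do rewrite exprMn; rewrite (opZ P) qE.
  have -> : 4 * (h ^+ 2 * q) ^+ 2 = h ^+ 4 * (4 * q ^+ 2) by ring.
  by apply: ler_wpM2l => //; rewrite exprn_ge0// ltW.
Qed.

(** The bound used for each observation: the right side depends on the direction only
    through the law of the perturbation. *)
Lemma psi_le_grid_smoothed x :
  psi (sg * (lam * (comb c o x ^+ 2 - 1))) <= grid_op zs (fun ks => ln (smoothed ks x)).
Proof.
have [b1 b2 b4] := perturbation_moments x.
have := psi_le_smoothed (grid_opP zs) b1 b2 b4 (comb c o x) sg2 lamb.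
move=> /le_trans; apply; rewrite le_eqVlt; apply/orP; left; apply/eqP.
by congr grid_op; apply/funext => ks; rewrite /smoothed grid_form_split.
Qed.

(** The terms in v come from the variance of the perturbation and from [slack]; with
    v = 0 one would find 1 + sg E h + E h^2 / 2 for h = lam (<t, X>^2 - 1). *)
Lemma grid_smoothed_mean : let xi := \sum_i c i ^+ 2 in 0 < xi -> 1 <= kappa ->
  grid_op zs (fun ks => Ex Q (smoothed ks)) <=
  1 + sg * (lam * (xi - 1)) + lam ^+ 2 / 2 * ((kappa - 1) * xi ^+ 2 + (xi - 1) ^+ 2)
  + 64 * lam ^+ 2 * v * kappa * r%:R * xi + 663 * lam ^+ 2 * v ^+ 2 * kappa * r%:R ^+ 2.
Proof.
move=> xi xi0 kappa1; have /andP[lam0 _] := lamb.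
have [iG <-] := @grid_op_Ex zs smoothed intg_smoothed.
pose a := comb c o; have Va : V a by exact: V_comb.
have sa := V_sq Va; have sa2 := V_4 Va; have sq := sqint_sqnorm.
have ia : intg Q (fun x => a x ^+ 2) by case: sa.
have iaa : intg Q (fun x => a x ^+ 2 * a x ^+ 2) by exact: sqint_mul.
have iaq : intg Q (fun x => a x ^+ 2 * sqnorm x) by exact: sqint_mul.
have iqq : intg Q (fun x => sqnorm x * sqnorm x) by exact: sqint_mul.
apply: (@le_trans _ _ (Ex Q (fun x => (1 - sg * lam + lam ^+ 2 / 2) +
   ((sg * lam - lam ^+ 2) * a x ^+ 2 + (lam ^+ 2 / 2 * (a x ^+ 2 * a x ^+ 2) +
   (64 * lam ^+ 2 * v * (a x ^+ 2 * sqnorm x) +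
    663 * lam ^+ 2 * v ^+ 2 * (sqnorm x * sqnorm x))))))).
  apply: Ex_le; first exact: iG.
    apply: intgD; first exact: intg_cst.
    apply: intgD; first exact: intgZ.
    apply: intgD; first exact: intgZ.
    by apply: intgD; exact: intgZ.
  move=> x; have [b1 b2 b4] := perturbation_moments x.
  have := smoothed_mean_le (grid_opP zs) b1 b2 b4 sg (a x) lam0 => /=.
  have -> : (fun ks => perturbed_factor sg lam (v * sqnorm x) (a x + h * grid_dev zs (coords x) ks))
     = smoothed^~ x.
    by apply/funext => ks; rewrite /smoothed grid_form_split.
  move=> /le_trans; apply; rewrite le_eqVlt; apply/orP; left; apply/eqP; by field.
rewrite ExD; [|exact: intg_cst|by do 3 (apply: intgD; first exact: intgZ); exact: intgZ].
rewrite Ex_cst.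
rewrite ExD; [|exact: intgZ|by do 2 (apply: intgD; first exact: intgZ); exact: intgZ].
rewrite ExD; [|exact: intgZ|by apply: intgD; exact: intgZ].
rewrite ExD; [|exact: intgZ|exact: intgZ].
rewrite !ExZ; [|done..]; rewrite Ex_comb_sqr -/xi.
have a2 : Ex Q (fun x => a x ^+ 2) = xi by exact: Ex_comb_sqr.
have := mixed_fourth_moment Va Va; rewrite !a2 => /(_ xi0 xi0) m4.
have := Ex_sqr_sqnorm Va; rewrite !a2 => /(_ xi0) mq.
have mqq := Ex_sqnorm2.
have l2 : 0 <= lam ^+ 2 / 2 by apply: divr_ge0; [exact: sqr_ge0|exact: ler0n].
have l64 : 0 <= 64 * lam ^+ 2 * v.
  by apply: mulr_ge0; [apply: mulr_ge0; [exact: ler0n|exact: sqr_ge0]|exact: ltW].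
have l663 : 0 <= 663 * lam ^+ 2 * v ^+ 2.
  by apply: mulr_ge0; [apply: mulr_ge0; [exact: ler0n|]|]; exact: sqr_ge0.
have := ler_wpM2l l2 m4; have := ler_wpM2l l64 mq; have := ler_wpM2l l663 mqq.
lra.
Qed.

End SmoothedMoments.

(** * Uniform deviations in orthonormal coordinates *)

Section UniformBound.
Context (R : realType) (d d' : measure_display) (T : measurableType d)
  (T' : measurableType d') (P : probability T R)
  (Q : probability T' R) (V : (T' -> R) -> Prop) (kappa : R).
Hypothesis V_lin : forall a f g, V f -> V g -> V (fun x => a * f x + g x).
Hypothesis V0 : V (fun=> 0).
Hypothesis V_sq : forall f, V f -> sqint Q f.
Hypothesis V_4 : forall f, V f -> sqint Q (fun x => f x ^+ 2).
Hypothesis V_kurt : forall f, V f -> Ex Q (fun x => f x ^+ 2) = 1 ->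
  Ex Q (fun x => f x ^+ 2 * f x ^+ 2) <= kappa.
Variables (r : nat) (o : 'I_r -> T' -> R).
Hypothesis oO : orthonormal_family Q V o.
Variables (n : nat) (Y : 'I_n -> {RV P >-> T'}).
Hypothesis ind : mutually_independent Y.
Hypothesis dist : forall i A, measurable A -> distribution P (Y i) A = Q A.

(** The PAC-Bayes bound.  Averaging the logarithms over the grid, the entropy
    inequality replaces the mean of the normalized log-product by the logarithm of
    its prior average, at most 1 / eps on the event, and ln B <= B - 1 takes care of
    the normalization.  The event depends on xi only through the size M of the prior's
    support. *)
Lemma uniform_deviation_event (v lam sg xi eps : R) :
  0 < v -> 0 <= lam <= 2 -> sg ^+ 2 = 1 -> 0 < xi -> 0 < eps -> 1 <= kappa ->
  exists A : set T, [/\ measurable A, ((1 - eps)%:E <= P A)%E &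
    forall w, A w -> forall c : 'I_r -> R, \sum_i c i ^+ 2 = xi ->
    \sum_(i < n) psi (sg * (lam * (comb c o (Y i w) ^+ 2 - 1))) <=
      n%:R * (sg * (lam * (xi - 1)) +
              lam ^+ 2 / 2 * ((kappa - 1) * xi ^+ 2 + (xi - 1) ^+ 2) +
              64 * lam ^+ 2 * v * kappa * r%:R * xi +
              663 * lam ^+ 2 * v ^+ 2 * kappa * r%:R ^+ 2) +
      73 / 100 * r%:R + 7 / 10 * (xi / (4 * v)) + ln eps^-1].
Proof.
move=> v0 lamb sg2 xi0 eps0 kappa1.
pose f := smoothed o v lam sg.
have intf ks : intg Q (f ks) by exact: (intg_smoothed V_lin V0 V_4 oO).
have f_ge ks x : 1 / 2 <= f ks x by exact: smoothed_ge.
have f_gt0 ks x : 0 < f ks x by have := f_ge ks x; lra.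
pose B ks := Ex Q (f ks).
have B_gt0 ks : 0 < B ks.
  apply: (@lt_le_trans _ _ (1 / 2)) => //.
  by rewrite -(Ex_cst Q (1 / 2)); apply: Ex_le => //; exact: intg_cst.
pose h := 2 * Num.sqrt v.
have h0 : 0 < h by rewrite mulr_gt0// sqrtr_gt0.
pose M := Num.bound (Num.sqrt xi / h).
have hM : Num.sqrt xi / h < M%:R.
  by apply: archi_boundP; rewrite divr_ge0 ?sqrtr_ge0 ?ltW.
have [A [mA PA hA]] := pac_bayes_event M.+1 r
  ind dist eps0 (fun ks => intg_meas (intf ks)) f_gt0 B_gt0 (fun ks => ExE (intf ks)).
exists A; split=> // w Aw c cxi.
pose zs := [seq c i / h | i <- enum 'I_r].
have szs : size zs = r by rewrite size_map size_enum_ord.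
have zsM : all (fun z => `|z| <= M%:R) zs.
  apply/allP => _ /mapP[i _ ->].
  rewrite normrM normfV (gtr0_norm h0); apply: le_trans (ltW hM).
  rewrite ler_pM2r ?invr_gt0// -sqrtr_sqr ler_sqrt; last exact: ltW.
  by rewrite -cxi (bigD1 i)//= lerDl sumr_ge0// => j _; exact: sqr_ge0.
have G := grid_opP zs.
pose L ks := \sum_(i < n) ln (f ks (Y i w) / B ks).
have step1 : \sum_(i < n) psi (sg * (lam * (comb c o (Y i w) ^+ 2 - 1))) <=
    grid_op zs (fun ks => \sum_(i < n) ln (f ks (Y i w))).
  rewrite (op_sum G); apply: ler_sum => i _.
  exact: psi_le_grid_smoothed.
have step2 : grid_op zs (fun ks => \sum_(i < n) ln (f ks (Y i w))) <=
    grid_op zs L + n%:R * (grid_op zs B - 1).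
  have -> : n%:R * (grid_op zs B - 1) = n%:R * grid_op zs B + - n%:R by ring.
  rewrite -[- n%:R](op_cst G) -(opZ G) -!(opD G).
  apply: (op_le G) => ks; rewrite /L.
  have -> : n%:R * B ks + - n%:R = \sum_(i < n) (B ks - 1).
    by rewrite sumr_const card_ord -mulr_natl; ring.
  rewrite -big_split/=; apply: ler_sum => i _.
  by rewrite ln_div ?posrE// -lerBlDl opprB addrC subrK; exact: ln_le_sub1.
have step3 : grid_op zs L <= ln eps^-1 + 73 / 100 * r%:R + 7 / 10 * (xi / (4 * v)).
  apply: le_trans (grid_prior_entropy L zsM) _.
  rewrite szs (centers_sqr v0) cxi lerD2r lerD2r.
  have e : (fun ks => expR (L ks)) = (fun ks => \prod_(i < n) (f ks (Y i w) / B ks)).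
    apply/funext => ks; rewrite /L expR_sum; apply: eq_bigr => i _.
    by rewrite lnK ?posrE ?divr_gt0.
  rewrite e ler_ln ?posrE ?invr_gt0//; first exact: hA.
  by apply: prior_op_gt0 => ks; apply: prodr_gt0 => i _; rewrite divr_gt0.
have := @grid_smoothed_mean _ _ _ Q V kappa V_lin V0 V_sq V_4 V_kurt r o oO v lam sg
  v0 lamb c.
rewrite cxi => /(_ xi0 kappa1) mean.
have n0 : 0 <= n%:R :> R by [].
have := ler_wpM2l n0 mean => {}mean.
apply: le_trans step1 _; apply: le_trans step2 _; move: step3 mean.
rewrite -/f -/zs -/B /=; lra.
Qed.
End UniformBound.

(** * Numerical inequalities *)

Section Numerics.
Variable R : realType.
Implicit Types (kappa eps mu lam s u q v xi delta : R).

Lemma sqrt_eq (x a : R) : 0 <= a -> a ^+ 2 = x -> Num.sqrt x = a.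
Proof. by move=> a0 <-; rewrite sqrtr_sqr ger0_norm. Qed.

Lemma sqrt2_bounds : 1414 / 1000 <= Num.sqrt (2 : R) <= 1415 / 1000.
Proof.
have h1 := sqr_sqrtr (ler0n R 2); have h2 := sqrtr_ge0 (2 : R).
move: h1 h2; move: (Num.sqrt _) => y h1 h2.
apply/andP; split; rewrite leNgt; apply/negP => h3.
  have h4 : y * y <= y * (1414 / 1000) by apply: ler_wpM2l => //; exact: ltW.
  lra.
have h4 : y * (1415 / 1000) <= y * y by apply: ler_wpM2l => //; exact: ltW.
lra.
Qed.

(** The parameters rewritten with s = lam (kappa - 1) and u = sqrt (kappa d / n):
    mu = s + 6.81 sqrt 2 u, and the sample size condition is the linear inequality
    20 u + (5/2) s + lam / 2 < 1. *)
Lemma parameter_facts kappa eps (n d : nat) :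
  1 < kappa -> 0 < eps <= 1 -> sample_threshold kappa d eps < n%:R ->
  let D := dev_term d eps in
  let lam := lambda_choice kappa n d eps in
  let s := lam * (kappa - 1) in
  let u := Num.sqrt (kappa * d%:R / n%:R) in
  let mu := mu_choice kappa n d eps in
  [/\ 0 < n%:R :> R, 73 / 100 * d%:R <= D, 0 <= lam & n%:R * lam * s = 2 * D] /\
  [/\ 0 <= u, n%:R * u ^+ 2 = kappa * d%:R, s + 96 / 10 * u <= mu <= s + 964 / 100 * u &
    20 * u + 5 / 2 * s + lam / 2 < 1].
Proof.
move=> k1 /andP[e0 e1] thr D lam s u mu.
have n0 : 0 < n%:R :> R by apply: le_lt_trans thr; exact: sqr_ge0.
have D0 : 73 / 100 * d%:R <= D.
  by rewrite /D /dev_term lerDr ln_ge0// invf_ge1.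
have dR : 0 <= d%:R :> R by [].
have D00 : 0 <= D by lra.
have lam0 : 0 <= lam by exact: sqrtr_ge0.
have u0 : 0 <= u by exact: sqrtr_ge0.
have k0 : 0 < kappa - 1 by lra.
have lam2 : lam ^+ 2 = 2 / ((kappa - 1) * n%:R) * D.
  by rewrite sqr_sqrtr// mulr_ge0// divr_ge0// mulr_ge0// ltW.
have u2 : u ^+ 2 = kappa * d%:R / n%:R.
  rewrite sqr_sqrtr//; apply: divr_ge0; last exact: ltW.
  by apply: mulr_ge0 => //; lra.
have s0 : 0 <= s by apply: mulr_ge0 => //; exact: ltW.
have sE : s ^+ 2 = 2 * (kappa - 1) / n%:R * D.
  by rewrite /s exprMn lam2; field; rewrite !gt_eqF.
have /andP[r21 r22] := sqrt2_bounds.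
have muE : mu = s + 681 / 100 * (Num.sqrt 2 * u).
  rewrite /mu /mu_choice (sqrt_eq s0 sE); congr (_ + _ * _).
  apply: sqrt_eq; first by rewrite mulr_ge0// sqrtr_ge0.
  by rewrite exprMn sqr_sqrtr// u2; field; rewrite gt_eqF.
split; split=> //.
- have -> : n%:R * lam * s = n%:R * (kappa - 1) * lam ^+ 2 by rewrite /s; ring.
  by rewrite lam2; field; rewrite !gt_eqF.
- by rewrite u2; field; rewrite gt_eqF.
- have h1 := ler_wpM2r u0 r21; have h2 := ler_wpM2r u0 r22.
  by rewrite muE; clear - u0 h1 h2; apply/andP; split; lra.
- have sn0 : 0 < Num.sqrt (n%:R : R) by rewrite sqrtr_gt0.
  have sn2 : Num.sqrt (n%:R : R) ^+ 2 = n%:R by rewrite sqr_sqrtr// ltW.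
  move: thr; rewrite /sample_threshold.
  have -> : Num.sqrt (kappa * d%:R) = Num.sqrt n%:R * u.
    apply: sqrt_eq; first by rewrite mulr_ge0// ltW.
    by rewrite exprMn sn2 u2; field; rewrite gt_eqF.
  have -> : Num.sqrt (2 * (kappa - 1) * dev_term d eps) = Num.sqrt n%:R * s.
    apply: sqrt_eq; first by rewrite mulr_ge0// ltW.
    by rewrite exprMn sn2 sE -/D; field; rewrite gt_eqF.
  set Z := 20 * u + 5 / 2 * s + lam / 2.
  have -> : 20 * (Num.sqrt n%:R * u) + (5 / 2 + 1 / (2 * (kappa - 1))) *
     (Num.sqrt n%:R * s) = Num.sqrt n%:R * Z.
    by rewrite /Z /s; field; rewrite gt_eqF.
  rewrite exprMn sn2 => hZ.
  rewrite ltNge; apply/negP => Z1.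
  move: hZ; rewrite ltNge => /negP; apply.
  rewrite -[leLHS]mulr1; apply: ler_wpM2l; first exact: ltW.
  by rewrite expr_ge1// (le_trans ler01).
Qed.

(** The choice of v makes lam v kappa d = u / 20, which balances the variance of the
    perturbation against its entropy 7 xi / (40 v); both become multiples of u.
    The term in v^2 is bounded through d <= n lam u, that is (kappa - 1) d <= 2 kappa D;
    this holds because D contains 0.73 d. *)
Lemma deviation_bound_le (n : nat) (rd d kappa D L lam s u sg xi : R) :
  let v := (20 * lam * n%:R * u)^-1 in
  0 < n%:R :> R -> 0 <= rd <= d -> 1 < kappa -> 0 < lam -> 0 < u -> 0 <= xi ->
  s = lam * (kappa - 1) -> n%:R * lam * s = 2 * D -> D = L + 73 / 100 * d ->
  d <= 2 * D -> n%:R * u ^+ 2 = kappa * d ->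
  n%:R * (sg * (lam * (xi - 1)) +
              lam ^+ 2 / 2 * ((kappa - 1) * xi ^+ 2 + (xi - 1) ^+ 2) +
              64 * lam ^+ 2 * v * kappa * rd * xi +
              663 * lam ^+ 2 * v ^+ 2 * kappa * rd ^+ 2) +
      73 / 100 * rd + 7 / 10 * (xi / (4 * v)) + L <=
  n%:R * lam * (sg * (xi - 1) + s / 2 * (1 + xi ^+ 2) + lam / 2 * (xi - 1) ^+ 2 +
     67 / 10 * u * xi + 1658 / 1000 * u).
Proof.
move=> v n0 /andP[r0 rd_d] k1 lam0 u0 xi0 sE DE DL dD uE.
have nl0 : 0 < n%:R * lam by exact: mulr_gt0.
have nlu0 : 0 < 20 * lam * n%:R * u by rewrite !mulr_gt0.
have v0 : 0 < v by rewrite invr_gt0.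
have vE : v * (20 * lam * n%:R * u) = 1 by rewrite mulVf// gt_eqF.
have d0 : 0 <= d by lra.
have t1 : n%:R * (64 * lam ^+ 2 * v * kappa * rd * xi) <= n%:R * lam * (32 / 10 * u * xi).
  have h1 : lam * v * (kappa * d) = u / 20.
    rewrite -uE; have -> : lam * v * (n%:R * u ^+ 2) = v * (20 * lam * n%:R * u) * u / 20.
      by field.
    by rewrite vE mul1r.
  have h2 : lam * v * kappa * rd <= u / 20.
    rewrite -h1 mulrA; apply: ler_wpM2l => //.
    by apply: mulr_ge0; [apply: mulr_ge0; exact: ltW|lra].
  have -> : n%:R * (64 * lam ^+ 2 * v * kappa * rd * xi) =
     (n%:R * lam * xi) * (64 * (lam * v * kappa * rd)) by ring.
  have -> : n%:R * lam * (32 / 10 * u * xi) = (n%:R * lam * xi) * (64 * (u / 20)) by field.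
  by apply: ler_wpM2l; [apply: mulr_ge0 => //; exact: ltW|lra].
have dle : d <= n%:R * lam * u.
  rewrite leNgt; apply/negP => hlt.
  have h1 : (n%:R * lam * u) ^+ 2 < d ^+ 2.
    by rewrite ltr_pXn2r// nnegrE// ltW// mulr_gt0.
  have h2 : (n%:R * lam * u) ^+ 2 * (kappa - 1) = 2 * D * kappa * d.
    have -> : (n%:R * lam * u) ^+ 2 * (kappa - 1) =
      (n%:R * lam * (lam * (kappa - 1))) * (n%:R * u ^+ 2) by ring.
    by rewrite -sE DE uE; ring.
  have dpos : 0 < d.
    by apply: le_lt_trans hlt; rewrite ltW// mulr_gt0.
  have h3 : d ^+ 2 * (kappa - 1) <= 2 * D * kappa * d.
    have -> : d ^+ 2 * (kappa - 1) = d * (d * (kappa - 1)) by ring.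
    have -> : 2 * D * kappa * d = d * (2 * D * kappa) by ring.
    by apply: ler_wpM2l => //; apply: ler_pM => //; lra.
  have h4 : (n%:R * lam * u) ^+ 2 * (kappa - 1) < d ^+ 2 * (kappa - 1).
    by rewrite ltr_pM2r//; lra.
  by move: h4; rewrite h2; clear - h3; lra.
have t2 : n%:R * (663 * lam ^+ 2 * v ^+ 2 * kappa * rd ^+ 2) <=
    n%:R * lam * (1658 / 1000 * u).
  have h1 : rd ^+ 2 <= d ^+ 2 by rewrite ler_pXn2r// nnegrE//; lra.
  have h2 : n%:R * (663 * lam ^+ 2 * v ^+ 2 * kappa * d ^+ 2) = 663 / 400 * d.
    have -> : n%:R * (663 * lam ^+ 2 * v ^+ 2 * kappa * d ^+ 2) =
      663 * n%:R * lam ^+ 2 * v ^+ 2 * (kappa * d) * d by ring.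
    rewrite -uE.
    have -> : 663 * n%:R * lam ^+ 2 * v ^+ 2 * (n%:R * u ^+ 2) * d =
      663 / 400 * (v * (20 * lam * n%:R * u)) ^+ 2 * d by field.
    by rewrite vE expr1n mulr1.
  apply: (@le_trans _ _ (663 / 400 * d)); last by clear - dle d0; lra.
  rewrite -h2; apply: ler_wpM2l; first exact: ltW.
  apply: ler_wpM2l; [|exact: h1]; apply: mulr_ge0; last by clear - k1; lra.
  by apply: mulr_ge0; [apply: mulr_ge0; [exact: ler0n|]|]; exact: sqr_ge0.
have t3 : 7 / 10 * (xi / (4 * v)) = n%:R * lam * (35 / 10 * u * xi).
  by rewrite /v invfM invrK; field.
have t4 : 73 / 100 * rd + L <= n%:R * lam * (s / 2).
  by clear - DE DL rd_d; lra.
have t5 : n%:R * (sg * (lam * (xi - 1)) +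
     lam ^+ 2 / 2 * ((kappa - 1) * xi ^+ 2 + (xi - 1) ^+ 2)) =
   n%:R * lam * (sg * (xi - 1) + s / 2 * xi ^+ 2 + lam / 2 * (xi - 1) ^+ 2).
  by rewrite sE; field.
rewrite t3; clear - t1 t2 t4 t5; lra.
Qed.

(** Since delta = mu + 2 mu delta and (s + lam) / 2 < 1 - 2 mu, the quadratic terms
    in delta are at most mu delta, and the constants 8.36 u and 6.7 u left over are
    smaller than mu - s. *)
Lemma lower_side_neg lam s u mu : 0 <= lam -> 0 <= s -> 0 < u ->
  s + 96 / 10 * u <= mu <= s + 964 / 100 * u -> 20 * u + 5 / 2 * s + lam / 2 < 1 ->
  let delta := mu / (1 - 2 * mu) in let xi := 1 + delta in
  -1 * (xi - 1) + s / 2 * (1 + xi ^+ 2) + lam / 2 * (xi - 1) ^+ 2 +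
     67 / 10 * u * xi + 1658 / 1000 * u < 0.
Proof.
move=> lam0 s0 u0 /andP[mu1 mu2] thr; set delta := mu / (1 - 2 * mu); rewrite /=.
set xi := 1 + delta.
have w0 : 0 < 1 - 2 * mu by lra.
have dE : delta * (1 - 2 * mu) = mu by rewrite mulfVK// gt_eqF.
have d0 : 0 <= delta by apply: divr_ge0; lra.
have h1 : delta ^+ 2 * ((s + lam) / 2) <= delta * mu.
  have -> : delta * mu = delta ^+ 2 * (1 - 2 * mu) by rewrite expr2 -mulrA dE.
  by apply: ler_wpM2l; [exact: sqr_ge0|lra].
have h2 : delta * (67 / 10 * u) <= delta * (mu - s) by apply: ler_wpM2l => //; lra.
rewrite /xi; lra.
Qed.

Lemma upper_side_neg lam s u mu : 0 <= lam -> 0 <= s -> 0 < u ->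
  s + 96 / 10 * u <= mu <= s + 964 / 100 * u -> 20 * u + 5 / 2 * s + lam / 2 < 1 ->
  let delta := mu / (1 - 2 * mu) in let xi := 1 - delta in 0 <= xi ->
  1 * (xi - 1) + s / 2 * (1 + xi ^+ 2) + lam / 2 * (xi - 1) ^+ 2 +
     67 / 10 * u * xi + 1658 / 1000 * u <= 0.
Proof.
move=> lam0 s0 u0 /andP[mu1 mu2] thr delta xi xi0.
have w0 : 0 < 1 - 2 * mu by lra.
have dE : delta * (1 - 2 * mu) = mu by rewrite mulfVK// gt_eqF.
have d0 : 0 <= delta by apply: divr_ge0; lra.
have h1 : delta ^+ 2 * (lam / 2) <= delta * mu.
  have -> : delta * mu = delta ^+ 2 * (1 - 2 * mu) by rewrite expr2 -mulrA dE.
  by apply: ler_wpM2l; [exact: sqr_ge0|lra].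
have h2 : s / 2 * (1 + xi ^+ 2) <= s.
  have : xi ^+ 2 <= 1 by rewrite exprn_ile1// /xi; lra.
  nra.
have h3 : 67 / 10 * u * xi <= 67 / 10 * u.
  by rewrite ger_pMr ?mulr_gt0// /xi; lra.
have h4 : 0 <= delta * mu by apply: mulr_ge0 => //; lra.
have -> : 1 * (xi - 1) + s / 2 * (1 + xi ^+ 2) + lam / 2 * (xi - 1) ^+ 2 +
   67 / 10 * u * xi + 1658 / 1000 * u = - delta + s / 2 * (1 + xi ^+ 2) +
   lam / 2 * delta ^+ 2 + 67 / 10 * u * xi + 1658 / 1000 * u by rewrite /xi; ring.
lra.
Qed.

(** From (a + b)^2 <= 2 a^2 + 2 b^2. *)
Lemma threshold_order kappa0 : 1 < kappa0 ->
  exists c : R, forall (d : nat) kappa eps, kappa0 <= kappa -> 0 < eps <= 1 ->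
    sample_threshold kappa d eps <= c * (kappa * (d%:R + ln eps^-1)).
Proof.
move=> k01; pose K := 5 / 2 + 1 / (2 * (kappa0 - 1)).
have k00 : 0 < kappa0 - 1 by lra.
have K0 : 0 < K by rewrite /K addr_gt0// divr_gt0// mulr_gt0.
exists (800 + 4 * K ^+ 2) => d kappa eps kk /andP[e0 e1].
have l0 : 0 <= ln eps^-1 by rewrite ln_ge0// invf_ge1.
have dR : 0 <= d%:R :> R by [].
rewrite /sample_threshold /dev_term; set L := ln _ in l0 *.
set x := Num.sqrt _; set y := Num.sqrt _; set K' := 5 / 2 + _.
have x2 : x ^+ 2 = kappa * d%:R by rewrite sqr_sqrtr// mulr_ge0//; clear - k01 kk; lra.
have y2 : y ^+ 2 = 2 * (kappa - 1) * (L + 73 / 100 * d%:R).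
  rewrite sqr_sqrtr//; apply: mulr_ge0; last by clear - l0 dR; lra.
  by clear - k01 kk; lra.
have K'0 : 0 <= K' by rewrite addr_ge0// divr_ge0// mulr_ge0//; clear - k01 kk; lra.
have K'K : K' <= K.
  rewrite /K /K' lerD2l !mul1r lef_pV2 ?posrE; [|rewrite mulr_gt0//..]; clear - k00 kk; lra.
apply: (@le_trans _ _ (800 * x ^+ 2 + 2 * (K' ^+ 2 * y ^+ 2))).
  by have h := sqr_ge0 (20 * x - K' * y); clear - h; lra.
rewrite x2 y2.
have h1 : K' ^+ 2 <= K ^+ 2 by rewrite ler_pXn2r// nnegrE// ltW.
have h2 : K' ^+ 2 * (2 * (kappa - 1) * (L + 73 / 100 * d%:R)) <=
    K ^+ 2 * (2 * kappa * (L + d%:R)).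
  apply: ler_pM => //; first exact: sqr_ge0.
    by apply: mulr_ge0; clear - k01 kk l0 dR; lra.
  by apply: ler_pM; clear - k01 kk l0 dR; lra.
have h3 : 0 <= kappa * L by apply: mulr_ge0 => //; clear - k01 kk; lra.
clear - h2 h3; lra.
Qed.

(** The sample size condition keeps 1 - 2 mu above 3/100, so the ratio is of the order
    of mu itself. *)
Lemma rate_order : exists c : R, forall (d n : nat) kappa eps,
  1 < kappa -> 0 < eps <= 1 -> sample_threshold kappa d eps < n%:R ->
  let mu := mu_choice kappa n d eps in
  mu / (1 - 2 * mu) <= c * Num.sqrt (kappa * (d%:R + ln eps^-1) / n%:R).
Proof.
exists 400 => d n kappa eps k1 eb thr; set mu := mu_choice _ _ _ _; rewrite /=.
have [[n0 D0 lam0 DE] [u0 uE mub thr']] := parameter_facts k1 eb thr.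
move: eb => /andP[e0 e1].
have l0 : 0 <= ln eps^-1 by rewrite ln_ge0// invf_ge1.
have dR : 0 <= d%:R :> R by [].
set lam := lambda_choice _ _ _ _ in lam0 DE mub thr'.
set s := lam * (kappa - 1) in DE mub thr'.
set u := Num.sqrt _ in u0 uE mub thr'.
set W := Num.sqrt _.
have W0 : 0 <= W by exact: sqrtr_ge0.
have k0 : 0 < kappa - 1 by rewrite subr_gt0.
have kp : 0 <= kappa by rewrite (le_trans ler01)// ltW.
have s0 : 0 <= s by apply: mulr_ge0 => //; exact: ltW.
have W2 : n%:R * W ^+ 2 = kappa * (d%:R + ln eps^-1).
  rewrite sqr_sqrtr; last first.
    by apply: divr_ge0; [exact: mulr_ge0 kp (addr_ge0 dR l0)|exact: ltW].
  by field; rewrite gt_eqF.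
have uW : u <= W.
  rewrite -(@ler_pXn2r _ 2)// ?nnegrE// -(ler_pM2l n0) uE W2.
  by apply: ler_wpM2l => //; rewrite lerDl.
have sW : s <= 2 * W.
  rewrite -(@ler_pXn2r _ 2)// ?nnegrE//; last exact: mulr_ge0.
  rewrite -(ler_pM2l n0).
  have -> : n%:R * s ^+ 2 = (kappa - 1) * (n%:R * lam * s) by rewrite /s; ring.
  have -> : n%:R * (2 * W) ^+ 2 = 4 * (n%:R * W ^+ 2) by ring.
  rewrite DE W2 /dev_term.
  have h : (kappa - 1) * (2 * (ln eps^-1 + 73 / 100 * d%:R)) <=
     kappa * (2 * (ln eps^-1 + d%:R)).
    apply: ler_pM; [exact: ltW| |by rewrite gerBl|].
      by apply: mulr_ge0 => //; apply: addr_ge0 => //; apply: mulr_ge0.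
    by clear - dR; lra.
  have h' : 0 <= kappa * (d%:R + ln eps^-1) by apply: mulr_ge0 => //; exact: addr_ge0.
  clear - h h'; lra.
move: mub => /andP[mu1 mu2]; rewrite -/mu in mu1 mu2.
have w0 : 3 / 100 <= 1 - 2 * mu by clear - mu2 thr' lam0 s0 u0; lra.
rewrite ler_pdivrMr; last by clear - w0; lra.
have h : 400 * W * (3 / 100) <= 400 * W * (1 - 2 * mu).
  by apply: ler_wpM2l; [apply: mulr_ge0; [exact: ler0n|exact: W0]|exact: w0].
clear - h mu2 sW uW W0; lra.
Qed.

End Numerics.

(** * Linear forms and the estimator *)

Section LinearForms.
Context (R : realType) (d : nat) (disp0 : measure_display)
  (T0 : measurableType disp0) (P0 : probability T0 R) (X : {RV P0 >-> d.-tuple R})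
  (kappa : R).
Hypothesis N_fin : forall t, (Nfun X t < +oo)%E.
Hypothesis M4_le : (ereal_sup [set moment 4 X t | t in [set t | Nfun X t <= 1]]
           <= kappa%:E)%E.

(** Expectations are taken on R^d, where samples and linear forms meet. *)
Definition law : probability (d.-tuple R) R := distribution P0 X.

Definition linear_form (f : d.-tuple R -> R) : Prop := exists t, f = dotp t.

Lemma dotp_lin a (t t' : d.-tuple R) :
  dotp [tuple a * tnth t i + tnth t' i | i < d] = fun x => a * dotp t x + dotp t' x.
Proof.
apply/funext => x; rewrite /dotp mulr_sumr -big_split/=.
by apply: eq_bigr => i _; rewrite tnth_mktuple; ring.
Qed.

Lemma linear_form_lin a f g : linear_form f -> linear_form g ->
  linear_form (fun x => a * f x + g x).
Proof.
move=> [t ->] [t' ->]; exists [tuple a * tnth t i + tnth t' i | i < d].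
by rewrite dotp_lin.
Qed.

Lemma linear_form0 : linear_form (fun=> 0).
Proof.
exists [tuple 0 | i < d]; apply/funext => x; rewrite /dotp big1// => i _.
by rewrite tnth_mktuple mul0r.
Qed.

Lemma measurable_dotp t : measurable_fun setT (@dotp R d t).
Proof.
rewrite /dotp; apply: (measurable_fun_big _ _ _).2 => i.
by apply: measurable_funM => //; exact: measurable_tnth.
Qed.

Lemma momentE p t : (forall x, 0 <= dotp t x ^+ p) ->
  moment p X t = (\int[law]_x (dotp t x ^+ p)%:E)%E.
Proof.
move=> p0; rewrite /moment unlock ge0_integral_distribution//.
apply/measurable_EFinP; apply: measurable_funX; exact: measurable_dotp.
Qed.

Let sq0 t x : 0 <= @dotp R d t x ^+ 2. Proof. exact: sqr_ge0. Qed.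
Let qu0 t x : 0 <= @dotp R d t x ^+ 4.
Proof. by rewrite (_ : 4 = 2 * 2)%N// exprM sqr_ge0. Qed.

Lemma intg_ge0 (f : d.-tuple R -> R) : measurable_fun setT f -> (forall x, 0 <= f x) ->
  (\int[law]_x (f x)%:E < +oo)%E -> intg law f.
Proof.
move=> mf f0 fi; apply/integrableP; split; first exact/measurable_EFinP.
by under eq_integral do rewrite /= ger0_norm//.
Qed.

Lemma linear_form_sqint f : linear_form f -> sqint law f.
Proof.
move=> [t ->]; split; first exact: measurable_dotp.
apply: intg_ge0 => //; first by apply: measurable_funX; exact: measurable_dotp.
by have := N_fin t; rewrite /Nfun momentE.
Qed.

Lemma NfunE t : Nfun X t = (Ex law (fun x => dotp t x ^+ 2))%:E.
Proof.
have [_ h] := @linear_form_sqint (dotp t) (ex_intro _ t erefl).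
by rewrite -ExE// /Nfun momentE.
Qed.

Lemma moment4_le t : Ex law (fun x => dotp t x ^+ 2) <= 1 ->
  intg law (fun x => dotp t x ^+ 2 * dotp t x ^+ 2) /\
  Ex law (fun x => dotp t x ^+ 2 * dotp t x ^+ 2) <= kappa.
Proof.
move=> N1.
have : (moment 4 X t <= kappa%:E)%E.
  apply: le_trans M4_le; apply: ereal_sup_ubound; exists t => //=.
  by rewrite NfunE lee_fin.
rewrite momentE//; have -> : (fun x => (dotp t x ^+ 4)%:E) =
    (fun x => (dotp t x ^+ 2 * dotp t x ^+ 2)%:E).
  by apply/funext => x; rewrite -exprD.
move=> h.
have i : intg law (fun x => dotp t x ^+ 2 * dotp t x ^+ 2).
  apply: intg_ge0 => [|x|].
  - by apply: measurable_funM; apply: measurable_funX; exact: measurable_dotp.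
  - by rewrite mulr_ge0.
  - by apply: le_lt_trans h _; rewrite ltry.
by split=> //; rewrite -lee_fin -ExE.
Qed.

(** The hypothesis bounds the fourth moment when N(t) <= 1; other directions are
    rescaled, by 1 / sqrt (N + 1) to avoid dividing by N = 0. *)
Lemma linear_form_sqint2 f : linear_form f -> sqint law (fun x => f x ^+ 2).
Proof.
move=> [t ->]; split; first by apply: measurable_funX; exact: measurable_dotp.
have [_ h] := @linear_form_sqint (dotp t) (ex_intro _ t erefl).
set N := Ex law (fun x => dotp t x ^+ 2).
have N0 : 0 <= N by apply: Ex_ge0 => x; exact: sqr_ge0.
pose a := (Num.sqrt (N + 1))^-1.
have a2 : a ^+ 2 = (N + 1)^-1 by rewrite exprVn sqr_sqrtr//; lra.
have N1 : 0 < N + 1 by lra.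
have a0 : a != 0 by rewrite invr_eq0 gt_eqF// sqrtr_gt0.
pose t' := [tuple a * tnth t i + tnth [tuple 0 | i < d] i | i < d].
have tE x : dotp t' x = a * dotp t x.
  rewrite /t' dotp_lin [X in _ + X](_ : _ = 0) ?addr0//.
  by rewrite /dotp big1// => i _; rewrite tnth_mktuple mul0r.
have [|i _] := @moment4_le t'.
  have -> : (fun x => dotp t' x ^+ 2) = (fun x => (N + 1)^-1 * dotp t x ^+ 2).
    by apply/funext => x; rewrite tE exprMn a2.
  by rewrite ExZ// -/N mulrC ler_pdivrMr// mul1r; lra.
have := intgZ (a ^- 4) i.
have -> // : (fun x => a ^- 4 * (dotp t' x ^+ 2 * dotp t' x ^+ 2)) =
  (fun x => (dotp t x ^+ 2) ^+ 2).
apply/funext => x; rewrite tE; field; exact: a0.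
Qed.

Lemma linear_form_kurtosis f : linear_form f -> Ex law (fun x => f x ^+ 2) = 1 ->
  Ex law (fun x => f x ^+ 2 * f x ^+ 2) <= kappa.
Proof. by move=> [t ->] N1; have [|_] := @moment4_le t; rewrite ?N1. Qed.

End LinearForms.

Section Quantile.
Context (R : realType) (d n : nat) (lam : R) (x : 'I_n -> d.-tuple R) (t : d.-tuple R).
Hypothesis lam0 : 0 <= lam.

Lemma Nhat_ge0 : (0 <= Nhat lam x t)%E.
Proof. by apply: le_ereal_inf_tmp => _ [rho [rho0 _] <-]; rewrite lee_fin ltW. Qed.

Lemma Nhat_le (rho : R) : 0 < rho ->
  \sum_(i < n) psi (lam * (rho^-1 * dotp t (x i) ^+ 2 - 1)) <= 0 ->
  (Nhat lam x t <= rho%:E)%E.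
Proof. by move=> rho0 h; apply: ereal_inf_lbound; exists rho. Qed.

(** The criterion is nonincreasing in rho, so one positive value bounds the infimum. *)
Lemma Nhat_ge (rho : R) : 0 < rho ->
  0 < \sum_(i < n) psi (lam * (rho^-1 * dotp t (x i) ^+ 2 - 1)) ->
  (rho%:E <= Nhat lam x t)%E.
Proof.
move=> rho0 h; apply: le_ereal_inf_tmp => _ [rho' [rho'0 h'] <-]; rewrite lee_fin leNgt.
apply/negP => lt; move: h; rewrite ltNge => /negP; apply; apply: le_trans h'.
apply: ler_sum => i _; apply: psi_mono; apply: ler_wpM2l => //.
rewrite lerD2r; apply: ler_wpM2r; first exact: sqr_ge0.
by rewrite lef_pV2// ltW.
Qed.

Lemma Nhat_eq0 : (forall i, dotp t (x i) = 0) -> Nhat lam x t = 0%E.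
Proof.
move=> x0; apply/eqP; rewrite eq_le Nhat_ge0 andbT.
apply/lee_addgt0Pr => e e0; rewrite add0e; apply: Nhat_le => //.
apply: sumr_le0 => i _; rewrite x0 expr0n/= mulr0 sub0r mulrN1.
have := psi_mono (_ : - lam <= 0); rewrite oppr_le0 => /(_ lam0).
by rewrite {2}/psi lexx psi_nonneg0.
Qed.

End Quantile.

(** * Coordinates modulo null directions *)

Section NullPerturbation.
Context (R : realType) (d : measure_display) (T : measurableType d)
  (Q : probability T R).

(** E (f + b k)^2 is affine in b when E k^2 = 0, and nonnegative for every b. *)
Lemma Ex_sqr_add_null (f k : T -> R) (a : R) : sqint Q f -> sqint Q k ->
  Ex Q (fun x => k x ^+ 2) = 0 ->
  Ex Q (fun x => (f x + a * k x) ^+ 2) = Ex Q (fun x => f x ^+ 2).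
Proof.
move=> sf sk k0.
have ifk : intg Q (fun x => f x * k x) by exact: sqint_mul.
have e b : Ex Q (fun x => (f x + b * k x) ^+ 2) =
    Ex Q (fun x => f x ^+ 2) + 2 * b * Ex Q (fun x => f x * k x).
  have -> : (fun x => (f x + b * k x) ^+ 2) =
    (fun x => f x ^+ 2 + (2 * b * (f x * k x) + b ^+ 2 * k x ^+ 2)).
    by apply/funext => x; ring.
  have [_ if2] := sf; have [_ ik2] := sk.
  rewrite ExD; [|done|by apply: intgD; exact: intgZ].
  rewrite ExD; [|exact: intgZ..].
  by rewrite (ExZ _ ifk) (ExZ _ ik2) k0 mulr0 addr0.
set C := Ex Q (fun x => f x * k x) in e.
have pos b : 0 <= Ex Q (fun x => f x ^+ 2) + 2 * b * C.
  by rewrite -e; apply: Ex_ge0 => x; exact: sqr_ge0.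
suff C0 : C = 0 by rewrite e C0 mulr0 addr0.
apply/eqP/negP => /negP C0.
(* an affine function of b that stays nonnegative is constant *)
have := pos (- (Ex Q (fun x => f x ^+ 2) + 1) / (2 * C)).
have -> : 2 * (- (Ex Q (fun x => f x ^+ 2) + 1) / (2 * C)) * C =
  - (Ex Q (fun x => f x ^+ 2) + 1) by field.
lra.
Qed.

Lemma Ex_sqr_add_nulls (I : Type) (s : seq I) (f : T -> R) (k : I -> T -> R)
    (a : I -> R) : sqint Q f -> (forall i, sqint Q (k i)) ->
  (forall i, Ex Q (fun x => k i x ^+ 2) = 0) ->
  Ex Q (fun x => (f x + \sum_(i <- s) a i * k i x) ^+ 2) = Ex Q (fun x => f x ^+ 2).
Proof.
move=> sf sk k0; elim: s => [|i s IH].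
  by congr Ex; apply/funext => x; rewrite big_nil addr0.
rewrite -IH -(@Ex_sqr_add_null (fun x => f x + \sum_(j <- s) a j * k j x) (k i) (a i))//.
  by congr Ex; apply/funext => x; rewrite big_cons; congr (_ ^+ 2); ring.
by apply: sqintD => //; apply: sqint_sum => j; exact: sqintZ.
Qed.

(** One null event for finitely many directions is enough: the others are linear
    combinations. *)
Lemma null_cover (I : eqType) (s : seq I) (B : I -> set T) :
  (forall i, measurable (B i)) -> (forall i, Q (B i) = 0%E) ->
  exists A : set T, [/\ measurable A, Q A = 0%E & forall i, i \in s -> B i `<=` A].
Proof.
move=> mB B0; elim: s => [|i s [A [mA A0 sub]]]; first by exists set0; split.
exists (B i `|` A); split; first exact: measurableU.
- by rewrite measureU0 //; exact: B0.
- move=> j; rewrite inE => /orP[/eqP->|/sub]; first exact: subsetUl.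
  by move=> /subset_trans; apply; exact: subsetUr.
Qed.

End NullPerturbation.

Section Coordinates.
Context (R : realType) (d : nat) (disp0 : measure_display)
  (T0 : measurableType disp0) (P0 : probability T0 R) (X : {RV P0 >-> d.-tuple R}).
Hypothesis N_fin : forall t, (Nfun X t < +oo)%E.

(** Only the d coordinate functions are decomposed; a general direction inherits its
    coordinates and a combination of the same null forms k i. *)
Lemma isotropic_coordinates : exists (r : nat) (f : 'I_r -> d.-tuple R -> R)
    (k : 'I_d -> d.-tuple R -> R),
  [/\ (r <= d)%N, orthonormal_family (law X) (@linear_form R d) f,
    forall i, linear_form (k i) /\ Ex (law X) (fun x => k i x ^+ 2) = 0 &
    forall t, exists c : 'I_r -> R, Nfun X t = (\sum_i c i ^+ 2)%:E /\
      forall x, dotp t x = comb c f x + \sum_i tnth t i * k i x].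
Proof.
pose g (i : 'I_d) (x : d.-tuple R) := tnth x i.
have lg i : linear_form (g i).
  exists [tuple (j == i)%:R | j < d]; apply/funext => x; rewrite /dotp (bigD1 i)//=.
  rewrite tnth_mktuple eqxx mul1r big1 ?addr0// => j /negbTE ji.
  by rewrite tnth_mktuple ji mul0r.
have [r [f [rd fO dec]]] := gram_schmidt (@linear_form_lin R d) (@linear_form0 R d)
  (linear_form_sqint N_fin) lg.
have /choice [c hc] := dec.
have /choice [k hk] := hc.
exists r, f, k; split=> // [i|t]; first by have [? ? _] := hk i.
have tE x : dotp t x = comb (fun j => \sum_i tnth t i * c i j) f x +
    \sum_i tnth t i * k i x.
  rewrite /dotp /comb.
  under [X in _ = X + _]eq_bigr do rewrite mulr_suml.
  rewrite exchange_big -big_split/=; apply: eq_bigr => i _.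
  have [_ _ /(_ x)] := hk i; rewrite /g /comb => ->; rewrite mulrDr mulr_sumr.
  by congr (_ + _); apply: eq_bigr => j _; rewrite mulrA.
pose ct j := \sum_i tnth t i * c i j.
exists ct; split=> //.
rewrite (NfunE N_fin); congr EFin.
rewrite -(Ex_comb_sqr fO).
rewrite -(@Ex_sqr_add_nulls _ _ _ (law X) 'I_d (index_enum 'I_d) (comb ct f) k (tnth t)).
- by congr Ex; apply/funext => x; rewrite tE.
- apply: (linear_form_sqint N_fin); apply: V_comb; first exact: linear_form_lin.
    exact: linear_form0.
  by have [] := fO.
- by move=> i; apply: (linear_form_sqint N_fin); have [] := hk i.
- by move=> i; have [] := hk i.
Qed.

End Coordinates.

(** * Deviation events and the theorem *)

Section Deviation.
Context (R : realType) (d n : nat) (kappa eps : R) (disp0 disp : measure_display)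
  (T0 : measurableType disp0) (T : measurableType disp)
  (P0 : probability T0 R) (P : probability T R)
  (X : {RV P0 >-> d.-tuple R}) (Xs : 'I_n -> {RV P >-> d.-tuple R}).
Hypothesis copies : independent_copies X Xs.
Hypothesis N_fin : forall t, (Nfun X t < +oo)%E.
Hypothesis M4_le : (ereal_sup [set moment 4 X t | t in [set t | Nfun X t <= 1]]
           <= kappa%:E)%E.
Hypothesis kappa1 : 1 < kappa.
Hypothesis eps01 : 0 < eps < 1.
Hypothesis n_large : sample_threshold kappa d eps < n%:R.

Let lam := lambda_choice kappa n d eps.
Let mu := mu_choice kappa n d eps.
Let s := lam * (kappa - 1).
Let u := Num.sqrt (kappa * d%:R / n%:R).

Let eps1 : 0 < eps <= 1. Proof. by move: eps01 => /andP[-> /ltW]. Qed.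

Let facts := parameter_facts kappa1 eps1 n_large.

Let lam_bounds : 0 <= lam <= 2.
Proof.
have [[n0 D0 lam0 DE] [u0 uE mub thr]] := facts.
have s0 : 0 <= s by apply: mulr_ge0 => //; rewrite subr_ge0 ltW.
move: thr; rewrite -/lam -/s -/u => thr; apply/andP; split=> //.
by move: u0; rewrite -/u => u0; lra.
Qed.

Let tail (sg xi : R) : R := sg * (xi - 1) + s / 2 * (1 + xi ^+ 2) +
  lam / 2 * (xi - 1) ^+ 2 + 67 / 10 * u * xi + 1658 / 1000 * u.

(** The value xi of the quadratic form is fixed; a direction with N(t) = N is rescaled
    to it, which turns the criterion at rho = N / xi into the criterion at 1. *)
Lemma deviation_event (sg xi : R) : sg ^+ 2 = 1 -> 0 < xi ->
  exists A : set T, [/\ measurable A, ((1 - eps)%:E <= P A)%E &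
    forall w, A w -> forall t : d.-tuple R,
      (Nfun X t = 0%E -> forall i, dotp t (Xs i w) = 0) /\
      forall N : R, 0 < N -> Nfun X t = N%:E ->
        [/\ 0 < lam, 0 < u & \sum_(i < n) psi (sg * (lam * ((N / xi)^-1 * dotp t (Xs i w) ^+ 2 - 1)))
        <= n%:R * lam * tail sg xi]].
Proof.
move=> sg2 xi0.
have [ind dist] := copies.
have [r [f [k [rd fO knull dec]]]] := isotropic_coordinates N_fin.
have sk i : sqint (law X) (k i).
  by apply: (linear_form_sqint N_fin); have [] := knull i.
have mk i : measurable [set x | k i x != 0].
  have := (sk i).1 measurableT (~` [set 0]) (measurableC (measurable_set1 _)).
  by rewrite setTI; congr measurable; apply/seteqP; split=> x /= /eqP.
have k0 i : law X [set x | k i x != 0] = 0%E.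
  by apply: (Ex_sqr_eq0 (sk i)); have [] := knull i.
have [Z [mZ Z0 subZ]] := null_cover (enum 'I_d) mk k0.
have mB i : measurable (Xs i @^-1` Z) by exact: measurable_funPTI.
have B0 i : P (Xs i @^-1` Z) = 0%E 
  by rewrite -[LHS]/(distribution P (Xs i) Z) (dist i) //; exact: Z0.
have [B [mBB BB0 subB]] := null_cover (enum 'I_n) mB B0.
have coordE w : ~ B w -> forall (i : 'I_n) t (c : 'I_r -> R),
    (forall x, dotp t x = comb c f x + \sum_i tnth t i * k i x) ->
    dotp t (Xs i w) = comb c f (Xs i w).
  move=> nB i t c ->; rewrite big1 ?addr0// => j _.
  have [->|kj] := eqVneq (k j (Xs i w)) 0; first by rewrite mulr0.
  exfalso; apply: nB; apply: (subB i); first by rewrite mem_enum.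
  by apply: (subZ j) => //; rewrite mem_enum.
have [[n0 D0 lam0 DE] [u0 uE mub thr]] := facts.
rewrite -/lam -/s in DE lam0; rewrite -/u in u0 uE.
have k1 : 0 < kappa - 1 by rewrite subr_gt0.
have [A1 [mA1 PA1 hA1]] : exists A : set T, [/\ measurable A, ((1 - eps)%:E <= P A)%E &
    forall w, A w -> forall c : 'I_r -> R, \sum_i c i ^+ 2 = xi ->
    [/\ 0 < lam, 0 < u & \sum_(i < n) psi (sg * (lam * (comb c f (Xs i w) ^+ 2 - 1)))
        <= n%:R * lam * tail sg xi]].
  have [dz|dpos] := posnP d.
    (* without coordinates the value xi > 0 of the quadratic form is not attained *)
    have rz : r = 0%N by apply/eqP; rewrite -leqn0 -dz.
    exists setT; split => //.
      rewrite probability_setT lee_fin; move: eps01 => /andP[]; lra.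
    move=> w _ c cxi; exfalso; move: xi0; rewrite -cxi big1 ?ltxx// => i _.
    by exfalso; move: i; rewrite rz => -[].
  have d1 : 1 <= d%:R :> R by rewrite ler1n.
  have lamp : 0 < lam.
    rewrite lt_neqAle lam0 andbT; apply/negP => /eqP l0.
    move: DE; rewrite -l0 mulr0 mul0r; lra.
  have up : 0 < u.
    rewrite lt_neqAle u0 andbT; apply/negP => /eqP l0.
    move: uE; rewrite -l0 expr0n/= mulr0 => /esym/eqP; rewrite mulf_eq0.
    by rewrite !gt_eqF//; lra.
  pose v := (20 * lam * n%:R * u)^-1.
  have v0 : 0 < v by rewrite invr_gt0 !mulr_gt0.
  have eps0 : 0 < eps by move: eps01 => /andP[].
  have [A [mA PA hA]] := uniform_deviation_event (@linear_form_lin R d)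
    (@linear_form0 R d) (linear_form_sqint N_fin) (linear_form_sqint2 N_fin M4_le)
    (linear_form_kurtosis N_fin M4_le) fO ind dist v0 lam_bounds sg2 xi0 eps0 (ltW kappa1).
  exists A; split=> // w Aw c cxi; split=> //.
  apply: le_trans (hA w Aw c cxi) _.
  apply: (@deviation_bound_le _ n r%:R d%:R kappa (dev_term d eps) (ln eps^-1)) => //.
  - by rewrite ler0n ler_nat.
  - exact: ltW.
  - by move: D0; lra.
(* the exceptional null set B does not depend on the direction *)
exists (A1 `\` B); split; first exact: measurableD.
  apply: (le_trans PA1).
  rewrite -(measureU0 (measurableD mA1 mBB) mBB BB0).
  apply: le_measure; rewrite ?inE//; first by apply: measurableU => //; exact: measurableD.
  by rewrite setDE setUIl setvU setIT; exact: subsetUl.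
move=> w [A1w nBw] t; have [c [Nt ct]] := dec t; rewrite Nt; split.
  move=> [c0] i; rewrite (coordE w nBw i t c ct) /comb big1// => j _.
  suff -> : c j = 0 by rewrite mul0r.
  apply/eqP; rewrite -sqrf_eq0; move/eqP: c0.
  rewrite psumr_eq0; last by move=> l _; exact: sqr_ge0.
  by move=> /allP/(_ j); rewrite mem_index_enum; apply.
move=> N Npos [cN].
have Nxi : 0 < xi / N by rewrite divr_gt0.
(* rescaling the direction by a brings the quadratic form to the value xi *)
pose a := Num.sqrt (xi / N).
have a2 : a ^+ 2 = xi / N by rewrite sqr_sqrtr// ltW.
have [|lp up h] := hA1 w A1w (fun j => a * c j).
  under eq_bigr do rewrite exprMn a2.
  by rewrite -mulr_sumr cN divfK// gt_eqF.
split=> //; move: h.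
rewrite (eq_bigr (fun i => psi (sg * (lam * ((N / xi)^-1 * dotp t (Xs i w) ^+ 2 - 1)))))//.
move=> i _; rewrite (coordE w nBw i t c ct) invf_div -a2 -exprMn.
congr (psi (_ * (_ * (_ ^+ 2 - 1)))).
by rewrite /comb mulr_sumr; apply: eq_bigr => j _; rewrite mulrA.
Qed.

Let delta := mu / (1 - 2 * mu).

Let mu_bounds : 0 <= mu /\ 0 < 1 - 2 * mu.
Proof.
have [[n0 D0 lam0 DE] [u0 uE /andP[mu1 mu2] thr]] := facts.
rewrite -/lam -/s -/u in mu1 mu2 thr lam0 u0; rewrite -/mu in mu1 mu2.
have s0 : 0 <= s by apply: mulr_ge0 => //; rewrite subr_ge0 ltW.
by split; lra.
Qed.

Let delta_ge0 : 0 <= delta.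
Proof. by have [m0 w0] := mu_bounds; apply: divr_ge0 => //; exact: ltW. Qed.

Let ratio (w : T) (t : d.-tuple R) := ediv_conv (Nfun X t) (Nhat lam (fun i => Xs i w) t).

Let N_pos t : Nfun X t = 0%E \/ exists2 N : R, 0 < N & Nfun X t = N%:E.
Proof.
rewrite (NfunE N_fin); set N := Ex _ _.
have : 0 <= N by apply: Ex_ge0 => x; exact: sqr_ge0.
rewrite le_eqVlt => /orP[/eqP<-|N0]; first by left.
by right; exists N.
Qed.

Let ratio_null w t : Nfun X t = 0%E -> (forall i, dotp t (Xs i w) = 0) ->
  ratio w t = 1%E.
Proof.
move=> N0 h; have /andP[lam0 _] := lam_bounds.
by rewrite /ratio N0 Nhat_eq0// /ediv_conv eqxx.
Qed.

Lemma lower_tail_event : exists A : set T, [/\ measurable A, ((1 - eps)%:E <= P A)%E &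
  forall w, A w -> forall t, (ratio w t - 1 <= delta%:E)%E].
Proof.
pose xi := 1 + delta; have xi0 : 0 < xi by exact: ltr_pwDl ltr01 delta_ge0.
have sg2 : (-1) ^+ 2 = 1 :> R by rewrite sqrrN expr1n.
have [A [mA PA hA]] := deviation_event sg2 xi0.
exists A; split=> // w Aw t; have [h0 hN] := hA w Aw t.
have [N0|[N Npos NE]] := N_pos t.
  by rewrite (ratio_null N0 (h0 N0)) subee// lee_fin.
have [lamp up h] := hN N Npos NE.
have [[n0 D0 lam0 DE] [u0 uE mub thr]] := facts.
rewrite -/lam -/s -/u -/mu in mub thr.
have s0 : 0 <= s by apply: mulr_ge0 => //; rewrite subr_ge0 ltW.
have tneg : tail (-1) xi < 0 by exact: lower_side_neg.
have pos : 0 < \sum_(i < n) psi (lam * ((N / xi)^-1 * dotp t (Xs i w) ^+ 2 - 1)).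
  rewrite -oppr_lt0 -sumrN; apply: (@le_lt_trans _ _ (n%:R * lam * tail (-1) xi)).
    apply: le_trans h; rewrite le_eqVlt; apply/orP; left; apply/eqP.
    by apply: eq_bigr => i _; rewrite mulN1r psiN.
  by rewrite pmulr_rlt0// mulr_gt0.
have rho0 : 0 < N / xi by rewrite divr_gt0.
have := @Nhat_ge R d n lam (fun i => Xs i w) t lam0 _ rho0 pos.
rewrite /ratio NE /ediv_conv; case: Nhat => [y| |] //=.
- rewrite lee_fin => hy; have y0 : 0 < y by apply: lt_le_trans hy.
  rewrite eqe gt_eqF// inver gt_eqF// -EFinM -EFinB lee_fin lerBlDl.
  rewrite ler_pdivrMr//; move: hy; rewrite ler_pdivrMr//.
  by rewrite mulrC.
- by move=> _; rewrite invey mule0 add0e lee_fin; have := delta_ge0; lra.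
Qed.

Lemma upper_tail_event : exists A : set T, [/\ measurable A, ((1 - eps)%:E <= P A)%E &
  forall w, A w -> forall t, (1 - ratio w t <= delta%:E)%E].
Proof.
have ratio_ge0 w t : (0 <= ratio w t)%E.
  rewrite /ratio /ediv_conv; case: ifP => _; first by case: ifP.
  apply: mule_ge0; last by rewrite inve_ge0; exact: Nhat_ge0.
  by have [->|[N /ltW N0 ->]] := N_pos t; rewrite ?lee_fin.
(* the ratio is nonnegative, so only delta < 1 carries information *)
have [d1|d1] := leP 1 delta.
  exists setT; split=> //.
    by rewrite probability_setT lee_fin; case/andP: eps01 => *; lra.
  move=> w _ t; have := ratio_ge0 w t; case: (ratio w t) => [y| |].
  - by rewrite -EFinB !lee_fin; lra.
  - by move=> _; exact: leNye.
  - by [].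
pose xi := 1 - delta; have xi0 : 0 < xi by rewrite subr_gt0.
have sg2 : 1 ^+ 2 = 1 :> R by rewrite expr1n.
have [A [mA PA hA]] := deviation_event sg2 xi0.
exists A; split=> // w Aw t; have [h0 hN] := hA w Aw t.
have [N0|[N Npos NE]] := N_pos t.
  by rewrite (ratio_null N0 (h0 N0)) subee// lee_fin.
have [lamp up h] := hN N Npos NE.
have [[n0 D0 lam0 DE] [u0 uE mub thr]] := facts.
rewrite -/lam -/s -/u -/mu in mub thr.
have s0 : 0 <= s by apply: mulr_ge0 => //; rewrite subr_ge0 ltW.
have tneg : tail 1 xi <= 0 by apply: upper_side_neg => //; exact: ltW.
have neg : \sum_(i < n) psi (lam * ((N / xi)^-1 * dotp t (Xs i w) ^+ 2 - 1)) <= 0.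
  apply: (@le_trans _ _ (n%:R * lam * tail 1 xi)).
    apply: le_trans h; rewrite le_eqVlt; apply/orP; left; apply/eqP.
    by apply: eq_bigr => i _; rewrite mul1r.
  by rewrite pmulr_rle0// mulr_gt0.
have rho0 : 0 < N / xi by rewrite divr_gt0.
have := Nhat_le rho0 neg; have := @Nhat_ge0 R d n lam (fun i => Xs i w) t.
rewrite /ratio NE /ediv_conv; case: Nhat => [y| |] //=.
rewrite !lee_fin eqe => y0 hy; have [y00|y00] := eqVneq y 0.
  by rewrite eqe gt_eqF//= leNye.
have {}y0 : 0 < y by rewrite lt_neqAle eq_sym y00.
rewrite inver gt_eqF// -EFinM -EFinB lee_fin lerBlDr -lerBlDl.
by rewrite ler_pdivlMr// mulrC -ler_pdivlMr.
Qed.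

End Deviation.

Lemma holds_with_prob_le0 (R : realType) (disp : measure_display)
    (T : measurableType disp) (P : probability T R) (p : R) (H : T -> Prop) :
  p <= 0 -> holds_with_prob_ge P p H.
Proof.
move=> p0; exists set0; split; first exact: measurable0.
  by rewrite measure0 lee_fin.
by move=> w.
Qed.

(** The union bound on complements. *)
Lemma holds_with_prob_geI (R : realType) (disp : measure_display)
    (T : measurableType disp) (P : probability T R) (a b : R) (H K L : T -> Prop) :
  holds_with_prob_ge P (1 - a) H -> holds_with_prob_ge P (1 - b) K ->
  (forall w, H w -> K w -> L w) -> holds_with_prob_ge P (1 - (a + b)) L.
Proof.
move=> [A [mA PA AH]] [B [mB PB BK]] HKL.
exists (A `&` B); split; first exact: measurableI.
  have PC (C : set T) : measurable C -> P C = (1 - fine (P (~` C)))%:E.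
    move=> mC; rewrite -[in LHS](setCK C) probability_setC//; last exact: measurableC.
    by rewrite EFinB fineK// fin_num_measure//; exact: measurableC.
  have mAB := measurableI _ _ mA mB.
  move: PA PB; rewrite (PC _ mA) (PC _ mB) (PC _ mAB) !lee_fin => PA PB.
  suff : fine (P (~` (A `&` B))) <= fine (P (~` A)) + fine (P (~` B)) by lra.
  rewrite setCI -lee_fin EFinD !fineK ?fin_num_measure//;
    try exact: measurableC; try by apply: measurableU; exact: measurableC.
  by apply: measureU2; exact: measurableC.
by move=> w [Aw Bw]; apply: HKL; [exact: AH|exact: BK].
Qed.

Theorem proposition1p1 (R : realType) :
  [/\
      forall (d n : nat) (kappa eps : R)
        (disp0 disp : measure_display)
        (T0 : measurableType disp0) (T : measurableType disp)
        (P0 : probability T0 R) (P : probability T R)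
        (X : {RV P0 >-> d.-tuple R}) (Xs : 'I_n -> {RV P >-> d.-tuple R}),
        independent_copies X Xs ->
        (forall t : d.-tuple R, (Nfun X t < +oo)%E) ->
        (ereal_sup [set moment 4 X t | t in [set t | Nfun X t <= 1]]
           <= kappa%:E)%E ->
        1 < kappa ->
        0 < eps ->
        sample_threshold kappa d eps < n%:R ->
        let lambda := lambda_choice kappa n d eps in
        let mu := mu_choice kappa n d eps in
        let r (w : T) (t : d.-tuple R) :=
          ediv_conv (Nfun X t) (Nhat lambda (fun i => Xs i w) t) in
        [/\ holds_with_prob_ge P (1 - 2 * eps)
              (fun w => forall t : d.-tuple R,
                (`| r w t - 1 | <= (mu / (1 - 2 * mu))%:E)%E),
            holds_with_prob_ge P (1 - eps)
              (fun w => forall t : d.-tuple R,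
                (r w t - 1 <= (mu / (1 - 2 * mu))%:E)%E) &
            holds_with_prob_ge P (1 - eps)
              (fun w => forall t : d.-tuple R,
                (1 - r w t <= (mu / (1 - 2 * mu))%:E)%E)],
      forall kappa0 : R, 1 < kappa0 ->
        exists c : R, forall (d : nat) (kappa eps : R),
          kappa0 <= kappa -> 0 < eps <= 1 ->
          sample_threshold kappa d eps <= c * (kappa * (d%:R + ln eps^-1)) &
      exists c : R, forall (d n : nat) (kappa eps : R),
        1 < kappa -> 0 < eps <= 1 ->
        sample_threshold kappa d eps < n%:R ->
        let mu := mu_choice kappa n d eps in
        mu / (1 - 2 * mu) <= c * Num.sqrt (kappa * (d%:R + ln eps^-1) / n%:R)].
Proof.
split; [|exact: threshold_order|exact: rate_order].
move=> d n kappa eps disp0 disp T0 T P0 P X Xs copies N_fin M4_le kappa1 eps0 n_large.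
move=> lambda mu r.
have [eps1|eps1] := leP 1 eps.
  by split; apply: holds_with_prob_le0; lra.
have eps01 : 0 < eps < 1 by rewrite eps0.
have low := lower_tail_event copies N_fin M4_le kappa1 eps01 n_large.
have upp := upper_tail_event copies N_fin M4_le kappa1 eps01 n_large.
have low' : holds_with_prob_ge P (1 - eps)
    (fun w => forall t, (r w t - 1 <= (mu / (1 - 2 * mu))%:E)%E).
  by have [A [mA PA hA]] := low; exists A.
have upp' : holds_with_prob_ge P (1 - eps)
    (fun w => forall t, (1 - r w t <= (mu / (1 - 2 * mu))%:E)%E).
  by have [A [mA PA hA]] := upp; exists A.
split=> //.
have -> : 2 * eps = eps + eps by ring.
apply: (holds_with_prob_geI low' upp') => w h1 h2 t.
have := h1 t; have := h2 t; case: (r w t) => [y| |] //=.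
rewrite -!EFinB !lee_fin => h3 h4; rewrite ler_norml; lra.
Qed.
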